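(* Fix $\omega\in(0,\sqrt{4/27})$. Then the quasi-periodic patterns $u(\xi)=p(\xi)e^{\mathbf{i}\theta(\xi)}$ (with $p^2\theta'=\omega$) near the periodic pattern $u_0(\xi)=p_1e^{\mathbf{i}k\xi}$, where $k^2+p_1^2=1$ and $kp_1^2=\omega$, of the real Ginzburg–Landau equation $u_t=(1-|u|^2)u+\partial_\xi^2u$ are spectrally unstable.
   Context: Steady solutions of the form $u(\xi)=p(\xi)e^{\mathbf{i}\theta(\xi)}$ with $p>0$ satisfy $p^2\theta'=\omega$ and $p''+f(p)=0$, where $f(p)=-\omega^2/p^3+p-p^3$. For $0<|\omega|<\sqrt{4/27}$, $f$ has two positive zeros $p_1<p_2$; here $p_1$ is the smaller one. The planar system for $(p,p')$ has a family of periodic orbits surrounding $(p_1,0)$. The quasi-periodic patterns are the $u=pe^{\mathbf{i}\theta}$ with $p$ a nonconstant periodic solution in this family; ''near $u_0$'' means that the periodic orbit $(p,p')$ is sufficiently close to $(p_1,0)$. Writing $u(\xi,t)=(\alpha(\xi,t)+\mathbf{i}\beta(\xi,t))e^{\mathbf{i}\theta(\xi)}$ with $\alpha,\beta$ real gives $$\alpha_t=\alpha_{\xi\xi}-\tfrac{2\omega}{p^2}\beta_\xi+\tfrac{2\omega p_\xi}{p^3}\beta+\bigl(1-\tfrac{\omega^2}{p^4}-(\alpha^2+\beta^2)\bigr)\alpha,$$ $$\beta_t=\beta_{\xi\xi}+\tfrac{2\omega}{p^2}\alpha_\xi-\tfrac{2\omega p_\xi}{p^3}\alpha+\bigl(1-\tfrac{\omega^2}{p^4}-(\alpha^2+\beta^2)\bigr)\beta,$$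 with steady solution $(p(\xi),0)$. The linearization about $(p,0)$ is $\mathcal{L}=\partial_\xi^2+a_1\partial_\xi+a_0$ on $L^2(\mathbb{R};\mathbb{C}^2)$ with domain $H^2(\mathbb{R};\mathbb{C}^2)$, where $$a_1=\begin{pmatrix}0&-\frac{2\omega}{p^2}\\ \frac{2\omega}{p^2}&0\end{pmatrix},\qquad a_0=\begin{pmatrix}1-\frac{\omega^2}{p^4}-3p^2&\frac{2\omega p_\xi}{p^3}\\-\frac{2\omega p_\xi}{p^3}&1-\frac{\omega^2}{p^4}-p^2\end{pmatrix}.$$ Spectrally unstable means that the spectrum of $\mathcal{L}$ intersects $\{\mathrm{Re}\,\lambda>0\}$. *)

(* Defs.v *)
From HB Require Import structures.
From mathcomp Require Import all_boot all_order all_algebra.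
From mathcomp Require Import all_classical all_reals all_analysis.
From mathcomp Require Import complex.

Set Implicit Arguments.
Unset Strict Implicit.
Unset Printing Implicit Defensive.

Import Order.TTheory GRing.Theory Num.Theory.
Import numFieldNormedType.Exports.

Local Open Scope classical_set_scope.
Local Open Scope ring_scope.
Local Open Scope complex_scope.

(** Elements of L^2(R; C^2) are represented by functions; equality in L^2 is
    equality almost everywhere. *)
Definition L2 (R : realType) (u : R -> 'cV[R[i]]_2) : Prop :=
  forall j : 'I_2,
    ((fun x => complex.Re (u x j 0)) \in Lfun (@lebesgue_measure R) 2%:E) /\
    ((fun x => complex.Im (u x j 0)) \in Lfun (@lebesgue_measure R) 2%:E).

Definition L2norm (R : realType) (u : R -> 'cV[R[i]]_2) : R :=
  Num.sqrt (\int[@lebesgue_measure R]_x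
    (\sum_(j < 2) Normc.normc (u x j 0) ^+ 2)).

Definition C1c (R : realType) (phi : R -> R) : Prop :=
  [/\ forall x, derivable phi x 1,
      continuous (derive1 phi) &
      compact (closure [set x | phi x != 0])].

(** Weak derivatives are tested against C^1_c functions, as in Brezis,
    "Functional Analysis, Sobolev Spaces and PDE", Section 8.2; testing against
    C^oo_c functions gives the same spaces. *)
Definition weak_derivative (R : realType) (f g : R -> R) : Prop :=
  forall phi : R -> R, C1c phi ->
    \int[@lebesgue_measure R]_x (f x * derive1 phi x) =
    - \int[@lebesgue_measure R]_x (g x * phi x).

Definition vweak_derivative (R : realType) (u v : R -> 'cV[R[i]]_2) : Prop :=
  forall j : 'I_2,
    weak_derivative (fun x => complex.Re (u x j 0))
                    (fun x => complex.Re (v x j 0)) /\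
    weak_derivative (fun x => complex.Im (u x j 0))
                    (fun x => complex.Im (v x j 0)).

(** [u] belongs to H^2(R; C^2), with weak derivatives [u1] and [u2]. *)
Definition H2 (R : realType) (u u1 u2 : R -> 'cV[R[i]]_2) : Prop :=
  [/\ L2 u, L2 u1, L2 u2, vweak_derivative u u1 & vweak_derivative u1 u2].

(** An unbounded operator A in L^2(R; C^2) is given by its graph [G]; [lambda]
    is in the resolvent set when A - lambda is a bijection from the domain of A
    onto L^2 with bounded inverse, (A - lambda) u = f being written
    A u = f + lambda u. *)
Definition resolvent_set (R : realType)
    (G : (R -> 'cV[R[i]]_2) -> (R -> 'cV[R[i]]_2) -> Prop) : set R[i] :=
  [set lambda | exists C : R, forall f, L2 f ->
    exists u,
      [/\ G u (fun x => f x + lambda *: u x),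
          L2norm u <= C * L2norm f &
          forall v, G v (fun x => f x + lambda *: v x) ->
            {ae @lebesgue_measure R, forall x, v x = u x}]].

Definition spectrum (R : realType)
    (G : (R -> 'cV[R[i]]_2) -> (R -> 'cV[R[i]]_2) -> Prop) : set R[i] :=
  ~` resolvent_set G.

(** u = p e^(i theta) is a steady solution of u_t = u_xx + (1 - |u|^2) u when
    p^2 theta' = omega and p'' + f(p) = 0, with f as follows. *)
Definition f_rGL (R : realType) (omega p : R) : R :=
  - omega ^+ 2 / p ^+ 3 + p - p ^+ 3.

Definition quasi_periodic_pattern (R : realType) (omega : R)
    (p theta : R -> R) : Prop :=
  [/\ forall xi, 0 < p xi,
      forall xi, derivable theta xi 1 /\ p xi ^+ 2 * derive1 theta xi = omega,
      forall xi, [/\ derivable p xi 1, derivable (derive1 p) xi 1 &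
                     derive1 (derive1 p) xi + f_rGL omega (p xi) = 0],
      exists T, 0 < T /\ forall xi, p (xi + T) = p xi &
      ~ exists c, forall xi, p xi = c].

Definition mx22 (R : realType) (a b c d : R) : 'M[R[i]]_2 :=
  \matrix_(i < 2, j < 2)
    (if i == 0 then (if j == 0 then a else b)
     else (if j == 0 then c else d))%:C.

Definition a1 (R : realType) (omega : R) (p : R -> R) (xi : R) : 'M[R[i]]_2 :=
  mx22 0                           (- (2 * omega / p xi ^+ 2))
       (2 * omega / p xi ^+ 2)     0.

Definition a0 (R : realType) (omega : R) (p : R -> R) (xi : R) : 'M[R[i]]_2 :=
  mx22 (1 - omega ^+ 2 / p xi ^+ 4 - 3 * p xi ^+ 2)
       (2 * omega * derive1 p xi / p xi ^+ 3)
       (- (2 * omega * derive1 p xi / p xi ^+ 3))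
       (1 - omega ^+ 2 / p xi ^+ 4 - p xi ^+ 2).

(** Graph of the linearization L = d^2 + a_1 d + a_0, with domain H^2, about
    (alpha, beta) = (p, 0), where u = (alpha + i beta) e^(i theta). *)
Definition linearization (R : realType) (omega : R) (p : R -> R)
    (u g : R -> 'cV[R[i]]_2) : Prop :=
  L2 g /\ exists u1 u2, H2 u u1 u2 /\
    {ae @lebesgue_measure R, forall xi,
      g xi = u2 xi + a1 omega p xi *m u1 xi + a0 omega p xi *m u xi}.

Definition spectrally_unstable (R : realType) (omega : R) (p : R -> R) : Prop :=
  spectrum (linearization omega p) `&` [set lambda | 0 < complex.Re lambda]
    !=set0.

(* Main.v *)
Require Import Defs.
From mathcomp Require Import all_boot all_order all_algebra.
From mathcomp Require Import all_classical all_reals all_analysis.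
From mathcomp Require Import measurable_realfun complex ring lra.
Import Order.TTheory GRing.Theory Num.Theory.
Import numFieldNormedType.Exports.
Local Open Scope classical_set_scope.
Local Open Scope ring_scope.
Set Implicit Arguments.
Unset Strict Implicit.
Unset Printing Implicit Defensive.

(** In the frame rotating with theta, the linearization about (p, 0) is the real
    operator L (a, b) = (a'' - q b' + c1 a + r b, b'' + q a' - r a + c2 b), where
    q = 2 omega / p^2 and r = 2 omega p' / p^3. Since q' = - 2 r, it is symmetric
    on H^2(R; R^2), and its Rayleigh quotient <L u, u> / <u, u> is bounded above.
    The supremum M of this quotient belongs to the spectrum
    ([rayleigh_sup_not_resolvent]): otherwise, for v almost maximizing, the
    bounded solution w of (M - L) w = v would make the nonnegative form
    <(M - L) u, u> negative at u = v - t w for some t. It is therefore enough to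
    find one state of positive Rayleigh quotient.

    At p = p1 the coefficients are constant, and L maps (A cos(nu x), B sin(nu x))
    to a function of the same kind, through a symmetric matrix that has a positive
    eigenvalue for some nu as soon as p1^2 < 2 k^2 ([unstable_mode]). As
    k^2 = 1 - p1^2, this means p1^2 < 2 / 3, which holds because p1 is the
    smaller zero of f ([p1_sqr_lt]). The corresponding eigenfunction is bounded
    but not square integrable; multiplying it by a slowly varying cutoff and
    replacing p1 by a function p close to p1 both change L v . v by a small
    multiple of |v|^2, pointwise ([test_pointwise]). The Rayleigh quotient thus
    stays positive.

    The symmetry of L on all of H^2 rests on integration by parts for weak
    derivatives ([H1_integration_by_parts]). Testing against C^1 approximations
    of indicators of intervals shows, by Lebesgue differentiation, that a weakly
    differentiable function is almost everywhere equal to a primitive of its weak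
    derivative ([weak_derivative_primitive]); primitives are integrated by parts
    on bounded intervals ([primitive_mul]), and the boundary terms are small at
    suitable points tending to infinity. *)

(** * Square integrable functions on the line *)

Section SquareIntegrable.
Context {R : realType}.
Local Notation mu := (@lebesgue_measure R).
Implicit Types f g c : R -> R.
(* sqint f: f is measurable and its square is integrable *)
Local Notation sqint f := (f \in Lfun mu 2%:E).
Local Notation rintegrable f := (mu.-integrable setT (EFin \o f)).

Lemma sqint_measurable f : sqint f -> measurable_fun setT f.
Proof. by rewrite inE => /andP[/[!inE]]. Qed.

Lemma sqint_mul_integrable f g :
  sqint f -> sqint g -> rintegrable (fun x => f x * g x).
Proof. by move=> fL gL; exact/Lfun1_integrable/Lfun2_mul_Lfun1. Qed.

Lemma sqintP f : measurable_fun setT f ->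
  rintegrable (fun x => f x ^+ 2) -> sqint f.
Proof.
move=> mf /integrableP[_ intf].
rewrite inE; apply/andP; split; rewrite inE//= /finite_norm unlock.
apply: poweR_lty; apply: le_lt_trans intf.
apply: ge0_le_integral => //=.
- apply/measurable_EFinP.
  apply/(@measurableT_comp _ _ _ _ _ _ (fun x : R => x `^ 2)%R) => //.
  exact/measurableT_comp.
- by apply/measurable_EFinP; apply: measurableT_comp => //; exact: measurable_funX.
- by move=> x _; rewrite lee_fin normrX powR_mulrn.
Qed.

Lemma rintegrable_le f g : measurable_fun setT f -> rintegrable g ->
  (forall x, `|f x| <= `|g x|) -> rintegrable f.
Proof.
move=> mf ig fg; apply: (le_integrable _ _ _ ig) => //.
  exact/measurable_EFinP.
by move=> x _ /=; rewrite lee_fin.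
Qed.

Lemma sqint_le f g : measurable_fun setT f -> sqint g ->
  (forall x, `|f x| <= `|g x|) -> sqint f.
Proof.
move=> mf gL fg; apply: sqintP => //.
apply: rintegrable_le (Lfun2_integrable_sqr gL) _ => [|x].
  exact: measurable_funX.
by rewrite !normrX lerXn2r ?nnegrE.
Qed.

Lemma sqintD f g : sqint f -> sqint g -> sqint (fun x => f x + g x).
Proof.
move=> fL gL; apply: sqintP.
  by apply: measurable_funD; exact: sqint_measurable.
have fg := sqint_mul_integrable fL gL.
have ff := sqint_mul_integrable fL fL.
have gg := sqint_mul_integrable gL gL.
have -> : (EFin \o (fun x => (f x + g x) ^+ 2)) =
   (fun x => (f x * f x)%:E + ((f x * g x)%:E + (f x * g x)%:E + (g x * g x)%:E))%E.
  by apply/funext => x /=; rewrite -!EFinD; congr EFin; ring.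
by apply: integrableD => //; apply: integrableD => //; apply: integrableD.
Qed.

Lemma sqint_bounded_mul c f (K : R) : measurable_fun setT c ->
  (forall x, `|c x| <= K) -> sqint f -> sqint (fun x => c x * f x).
Proof.
move=> mc cK fL; apply: sqintP.
  by apply: measurable_funM => //; exact: sqint_measurable.
have ff := sqint_mul_integrable fL fL.
apply: (@rintegrable_le _ (fun x => K ^+ 2 * (f x * f x))) => [||x].
- by apply: measurable_funX; apply: measurable_funM => //; exact: sqint_measurable.
- exact: (integrableZl measurableT (K ^+ 2) ff).
- rewrite -expr2 -exprMn !normrX lerXn2r ?nnegrE// !normrM ler_wpM2r//.
  exact: le_trans (cK x) (ler_norm _).
Qed.

Lemma sqintZ (a : R) f : sqint f -> sqint (fun x => a * f x).
Proof. by move=> fL; apply: (@sqint_bounded_mul (cst a) f `|a|). Qed.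

Lemma sqintB f g : sqint f -> sqint g -> sqint (fun x => f x - g x).
Proof.
move=> fL gL; have := sqintD fL (sqintZ (-1) gL).
by under [X in X \in _ -> _]eq_fun do rewrite mulN1r.
Qed.

End SquareIntegrable.

(** * C^1 test functions and weak derivatives *)

Section TestFunctions.
Context {R : realType}.
Local Notation mu := (@lebesgue_measure R).
Implicit Types f g q phi : R -> R.
Local Notation sqint f := (f \in Lfun mu 2%:E).
Local Notation rintegrable f := (mu.-integrable setT (EFin \o f)).

Lemma derivable_continuous f : (forall x, derivable f x 1) -> continuous f.
Proof. by move=> df x; exact/differentiable_continuous/derivable1_diffP. Qed.

Lemma bounded_on_segment f (N : R) : continuous f ->
  exists2 K, 0 <= K & forall x, `|x| <= N -> `|f x| <= K.
Proof.
move=> cf; have [N0|N0] := ltP N 0.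
  by exists 0 => // x xN; have := le_lt_trans (le_trans (normr_ge0 x) xN) N0; rewrite ltxx.
have cnf : continuous (fun x => `|f x|).
  by move=> x; apply: cvg_norm; exact: cf.
have NN : - N <= N by lra.
have [c _ cmax] := EVT_max NN (continuous_subspaceT (A := `[- N, N]) cnf).
exists (`|f c|) => // x xN; apply: cmax.
by rewrite in_itv/= -ler_norml.
Qed.

Lemma C1cP phi : (forall x, derivable phi x 1) -> continuous (derive1 phi) ->
  forall N, (forall x, N < `|x| -> phi x = 0) -> C1c phi.
Proof.
move=> dphi cphi N phi0; split => //.
apply: (@subclosed_compact _ _ `[- N, N]%classic).
- exact: closed_closure.
- exact: segment_compact.
- rewrite [X in _ `<=` X](iffLR (closure_id _)); last exact: interval_closed.
  apply: closureS => x /= phix; rewrite in_itv/= -ler_norml leNgt.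
  by apply/negP => /phi0 /eqP; rewrite (negbTE phix).
Qed.

Lemma C1c_support phi : C1c phi -> exists2 N, 0 < N &
  forall x, N < `|x| -> phi x = 0 /\ derive1 phi x = 0.
Proof.
move=> [dphi cphi /compact_bounded[M [_ /(_ (`|M| + 1))]]].
rewrite (le_lt_trans (ler_norm M)) ?ltrDl// => /(_ isT) bnd.
exists (`|M| + 1); first by rewrite ltr_wpDl.
have phi0 x : `|M| + 1 < `|x| -> phi x = 0.
  move=> Mx; apply/eqP; apply/negPn/negP => phix.
  have := bnd x (@subset_closure _ [set x | phi x != 0] x phix).
  by rewrite /= leNgt Mx.
move=> x Mx; split; first exact: phi0.
rewrite derive1E (@near_eq_derive _ _ _ phi (cst 0)) ?derive_cst//.
have cn : {for x, continuous (fun y : R => `|y|)} by exact: norm_continuous.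
near=> y; apply: phi0.
by near: y; exact: (cvgr_gt _ cn).
Unshelve. all: by end_near. Qed.

Lemma sqint_compact_support f (N : R) : continuous f ->
  (forall x, N < `|x| -> f x = 0) -> sqint f.
Proof.
move=> cf f0; have [K K0 fK] := bounded_on_segment N cf.
have mf : measurable_fun setT f by exact: continuous_measurable_fun.
apply: sqintP => //.
apply: (@rintegrable_le _ _ (fun x => K ^+ 2 * \1_(`[- N, N]%classic) x)) => [||x].
- exact: measurable_funX.
- exact: (integrableZl measurableT (K ^+ 2) (integrable_indic_itv (- N) N true false)).
- rewrite indicE mem_setE in_itv/= -ler_norml.
  have [xN|/f0 ->] := leP `|x| N; last by rewrite expr0n/= normr0.
  rewrite mulr1 !normrX lerXn2r ?nnegrE//.
  by rewrite (ger0_norm K0) fK.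
Qed.

Lemma C1c_sqint phi : C1c phi -> sqint phi /\ sqint (derive1 phi).
Proof.
move=> C; have [N N0 phi0] := C1c_support C; case: C => dphi cphi _.
by split; apply: (@sqint_compact_support _ N) => [|x /phi0[]//];
  [exact: derivable_continuous|].
Qed.

Lemma Rintegral_derive1 f (a b : R) : a < b ->
  (forall x, derivable f x 1) -> continuous (derive1 f) ->
  \int[mu]_(x in `[a, b]) derive1 f x = f b - f a.
Proof.
move=> ab df cf; have cf0 := derivable_continuous df.
have LR : derivable_oo_LRcontinuous f a b.
  split=> [x _| |]; first exact: df.
    by apply: cvg_at_right_filter; exact: cf0.
  by apply: cvg_at_left_filter; exact: cf0.
have cfab : {within `[a, b], continuous (derive1 f)} by exact: continuous_subspaceT.
by rewrite /Rintegral (continuous_FTC2 ab cfab LR (fun x _ => erefl)).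
Qed.

Lemma Rintegral_support f (A : set R) : (forall x, ~ A x -> f x = 0) ->
  \int[mu]_x f x = \int[mu]_(x in A) f x.
Proof.
move=> f0; rewrite [RHS]Rintegral_mkcond; congr (Rintegral _ _ _).
apply/funext => x; rewrite patchE; case: ifPn => // /negP xA.
by apply: f0 => Ax; apply: xA; rewrite inE.
Qed.

Lemma C1c_integral_derive1 phi : C1c phi -> \int[mu]_x derive1 phi x = 0.
Proof.
move=> C; have [N N0 phi0] := C1c_support C; case: C => dphi cphi _.
rewrite (@Rintegral_support _ `[- (N + 1), N + 1]%classic); last first.
  move=> x /= /negP; rewrite in_itv/= -ler_norml -ltNge => xN.
  by have [] // := phi0 x _; rewrite (lt_trans _ xN)// ltrDl.
rewrite Rintegral_derive1 ?gtrN ?addr_gt0//.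
by rewrite !(phi0 _ _).1 ?subrr// ?normrN gtr0_norm ?addr_gt0// ltrDl.
Qed.

Lemma derive1M f g x : derivable f x 1 -> derivable g x 1 ->
  derive1 (fun y => f y * g y) x = derive1 f x * g x + f x * derive1 g x.
Proof.
move=> df dg; rewrite !derive1E (deriveM df dg) addrC /GRing.scale/=.
by rewrite [g x * _]mulrC.
Qed.

Lemma C1c_mul f phi : (forall x, derivable f x 1) -> continuous (derive1 f) ->
  C1c phi -> C1c (fun x => f x * phi x).
Proof.
move=> df cf C; have [N N0 phi0] := C1c_support C; case: C => dphi cphi _.
apply: (@C1cP _ _ _ N) => [x||x /phi0[-> _]]; last by rewrite mulr0.
- exact: derivableM.
- have -> : derive1 (fun x => f x * phi x) =
      (fun x => derive1 f x * phi x + f x * derive1 phi x).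
    by apply/funext => x; exact: derive1M.
  have cf0 := derivable_continuous df; have cphi0 := derivable_continuous dphi.
  move=> x; apply: cvgD; apply: cvgM; [exact: cf|exact: cphi0|exact: cf0|exact: cphi].
Qed.

(** A continuously differentiable function is weakly differentiable. *)
Lemma weak_derivative_C1 f : (forall x, derivable f x 1) ->
  continuous (derive1 f) -> sqint f -> sqint (derive1 f) ->
  weak_derivative f (derive1 f).
Proof.
move=> df cf fL f'L phi C; have [phiL phi'L] := C1c_sqint C.
have dphi : forall x, derivable phi x 1 by case: C.
have := C1c_integral_derive1 (C1c_mul df cf C).
under eq_Rintegral => x _ do rewrite derive1M//.
rewrite RintegralD//; [|exact: sqint_mul_integrable..].
by rewrite addrC => /eqP; rewrite addr_eq0 => /eqP.
Qed.

(** Leibniz rule for a C^1 factor [q] which is bounded together with its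
    derivative. *)
Lemma weak_derivative_mul q f f1 (K : R) :
  (forall x, derivable q x 1) -> continuous (derive1 q) ->
  (forall x, `|q x| <= K) -> (forall x, `|derive1 q x| <= K) ->
  sqint f -> sqint f1 -> weak_derivative f f1 ->
  weak_derivative (fun x => q x * f x) (fun x => derive1 q x * f x + q x * f1 x).
Proof.
move=> dq cq qK q'K fL f1L w phi C; have [phiL phi'L] := C1c_sqint C.
have dphi : forall x, derivable phi x 1 by case: C.
have cphi' : continuous (derive1 phi) by case: C.
have cq0 := derivable_continuous dq.
have mq := continuous_measurable_fun cq0.
have mq' := continuous_measurable_fun cq.
have := w _ (C1c_mul dq cq C).
under eq_Rintegral => x _ do rewrite derive1M// mulrDr.
have qp : sqint (fun x => q x * phi x) by exact: (@sqint_bounded_mul _ _ _ K).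
have q'p : sqint (fun x => derive1 q x * phi x) by exact: (@sqint_bounded_mul _ _ _ K).
have qp' : sqint (fun x => q x * derive1 phi x) by exact: (@sqint_bounded_mul _ _ _ K).
have i1 := sqint_mul_integrable fL qp.
have i2 := sqint_mul_integrable fL q'p.
have i3 := sqint_mul_integrable fL qp'.
have i4 := sqint_mul_integrable f1L qp.
rewrite RintegralD// => E.
rewrite (_ : (fun x => q x * f x * derive1 phi x) =
  (fun x => f x * (q x * derive1 phi x))); last by apply/funext => x; ring.
rewrite (_ : (fun x => (derive1 q x * f x + q x * f1 x) * phi x) =
  (fun x => f x * (derive1 q x * phi x) + f1 x * (q x * phi x))); last first.
  by apply/funext => x; ring.
by rewrite RintegralD//; lra.
Qed.

End TestFunctions.

(** * C^1 step functions *)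

Section Steps.
Context {R : realType}.
Implicit Types a h t : R.
Local Notation mu := (@lebesgue_measure R).

Lemma is_derive_quadratic_remainder (f : R -> R) (x l K : R) :
  (forall h, `|f (h + x) - f x - h * l| <= K * h ^+ 2) -> is_derive x 1 f l.
Proof.
move=> fK.
have lim : h^-1 *: ((f \o shift x) (h *: (1 : R)) - f x) @[h --> 0^'] --> l.
  apply/cvgrPdist_le => e e0; near=> h => /=.
  have h0 : h != 0 by near: h; exact: nbhs_dnbhs_neq.
  have Kh : `|h| <= e / (`|K| + 1).
    by near: h; apply: dnbhs0_le; rewrite divr_gt0// ltr_wpDl.
  have -> : l - h^-1 *: (f (h *: 1 + x) - f x) = - (h^-1 * (f (h + x) - f x - h * l)).
    by rewrite /GRing.scale /= mulr1; field.
  rewrite normrN normrM normfV ler_pdivrMl ?normr_gt0//.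
  apply: (le_trans (fK h)); rewrite -(real_normK (num_real h)) expr2 mulrCA ler_wpM2l//.
  move: Kh; rewrite ler_pdivlMr ?ltr_wpDl// => Kh.
  apply: le_trans Kh; rewrite mulrC ler_wpM2l//.
  by rewrite (le_trans (ler_norm K))// lerDl.
apply: DeriveDef; last exact/cvg_lim.
by apply/cvg_ex; exists l.
Unshelve. all: by end_near. Qed.

(** The positive part of [t], and half of its square, which is a C^1 primitive
    of it. *)
Definition pos (t : R) := Num.max 0 t.
Definition qpos (t : R) := pos t ^+ 2 / 2.

Lemma posE (t : R) : pos t = t /\ 0 <= t \/ pos t = 0 /\ t <= 0.
Proof. by rewrite /pos; case: (lerP 0 t) => [|/ltW]; [left|right]. Qed.

Lemma is_derive_qpos t : is_derive t 1 qpos (pos t).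
Proof.
apply: (@is_derive_quadratic_remainder _ _ _ 1) => h; rewrite /qpos mul1r ler_norml.
have [[-> ?]|[-> ?]] := posE (h + t); have [[-> ?]|[-> ?]] := posE t;
  by apply/andP; split; nra.
Qed.

Lemma continuous_pos : continuous pos.
Proof. by move=> t; apply: continuous_max; [exact: cvg_cst|exact: cvg_id]. Qed.

(** A hat function of integral 1 supported in [a, a + 2h], and its primitive
    [step], a C^1 function which increases from 0 to 1 there. *)
Definition hat (a h t : R) :=
  (pos (t - a) - 2 * pos (t - a - h) + pos (t - a - 2 * h)) / h ^+ 2.
Definition step (a h t : R) :=
  (qpos (t - a) - 2 * qpos (t - a - h) + qpos (t - a - 2 * h)) / h ^+ 2.

Lemma is_derive_step a h t : is_derive t 1 (step a h) (hat a h t).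
Proof.
have dq c : is_derive t 1 (fun s => qpos (s - c)) (pos (t - c)).
  have := @is_derive1_comp R qpos (fun s => s - c) t (pos (t - c)) 1.
  rewrite mulr1; apply; first exact: is_derive_qpos.
  by have := is_deriveB (is_derive_id t 1) (is_derive_cst c t 1); rewrite subr0.
have -> : step a h = (fun s => (h ^+ 2)^-1 *
    (qpos (s - a) - 2 * qpos (s - (a + h)) + qpos (s - (a + 2 * h)))).
  by apply/funext => s; rewrite /step !opprD !addrA [RHS]mulrC.
have -> : hat a h t = (h ^+ 2)^-1 *:
    (pos (t - a) - 2 *: pos (t - (a + h)) + pos (t - (a + 2 * h))).
  by rewrite /hat /GRing.scale/= !opprD !addrA [RHS]mulrC.
exact: (is_deriveZ (h ^+ 2)^-1 (is_deriveD (is_deriveB (dq a)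
  (is_deriveZ 2 (dq (a + h)))) (dq (a + 2 * h)))).
Qed.

Lemma continuous_hat a h : continuous (hat a h).
Proof.
have cp c : continuous (fun t => pos (t - c)).
  move=> t; apply: (@continuous_comp _ _ _ (fun t => t - c) pos).
    by apply: cvgB; [exact: cvg_id|exact: cvg_cst].
  exact: continuous_pos.
have -> : hat a h = (fun t => (pos (t - a) - 2 * pos (t - (a + h)) +
                               pos (t - (a + 2 * h))) * (h ^+ 2)^-1).
  by apply/funext => s; rewrite /hat !opprD !addrA.
move=> t; apply: cvgM; last exact: cvg_cst.
apply: cvgD; last exact: cp.
by apply: cvgB; [exact: cp|apply: cvgM; [exact: cvg_cst|exact: cp]].
Qed.

Lemma derive1_step a h : derive1 (step a h) = hat a h.
Proof. by apply/funext => t; rewrite derive1E; have := is_derive_step a h t => -[]. Qed.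

Lemma hat_bounds a h t : 0 < h -> 0 <= hat a h t <= h^-1.
Proof.
move=> h0; have h2 : 0 < h ^+ 2 by rewrite exprn_gt0.
apply/andP; split.
  apply: divr_ge0; last exact: ltW.
  have [[-> ?]|[-> ?]] := posE (t - a); have [[-> ?]|[-> ?]] := posE (t - a - h);
  have [[-> ?]|[-> ?]] := posE (t - a - 2 * h); lra.
rewrite /hat ler_pdivrMr// expr2 mulrA mulVf ?gt_eqF// mul1r.
have [[-> ?]|[-> ?]] := posE (t - a); have [[-> ?]|[-> ?]] := posE (t - a - h);
  have [[-> ?]|[-> ?]] := posE (t - a - 2 * h); lra.
Qed.

Lemma hat_out a h t : 0 < h -> t < a \/ a + 2 * h < t -> hat a h t = 0.
Proof.
move=> h0 H; rewrite /hat.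
apply/eqP; rewrite mulf_eq0; apply/orP; left; apply/eqP.
have [[-> ?]|[-> ?]] := posE (t - a); have [[-> ?]|[-> ?]] := posE (t - a - h);
  have [[-> ?]|[-> ?]] := posE (t - a - 2 * h); case: H => ?; lra.
Qed.

Lemma step_bounds a h t : 0 < h -> 0 <= step a h t <= 1.
Proof.
move=> h0; have h2 : 0 < h ^+ 2 by rewrite exprn_gt0.
rewrite /step /qpos; apply/andP; split.
  apply: divr_ge0; last exact: ltW.
  have [[-> ?]|[-> ?]] := posE (t - a); have [[-> ?]|[-> ?]] := posE (t - a - h);
  have [[-> ?]|[-> ?]] := posE (t - a - 2 * h); nra.
rewrite ler_pdivrMr// mul1r.
have [[-> ?]|[-> ?]] := posE (t - a); have [[-> ?]|[-> ?]] := posE (t - a - h);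
  have [[-> ?]|[-> ?]] := posE (t - a - 2 * h); nra.
Qed.

Lemma step_left a h t : 0 < h -> t <= a -> step a h t = 0.
Proof.
move=> h0 ta; have pos0 s : s <= 0 -> pos s = 0 by case: (posE s) => -[->]; lra.
by rewrite /step /qpos !pos0 ?expr0n/= ?mul0r ?mulr0 ?subr0 ?addr0 ?mul0r; lra.
Qed.

Lemma step_right a h t : 0 < h -> a + 2 * h <= t -> step a h t = 1.
Proof.
move=> h0 ta; have pos_id s : 0 <= s -> pos s = s by case: (posE s) => -[->]; lra.
by rewrite /step /qpos !pos_id; [field; rewrite gt_eqF|lra..].
Qed.

End Steps.

(** * Increments of weakly differentiable functions *)

Section Representative.
Context {R : realType}.
Local Notation mu := (@lebesgue_measure R).
Local Notation sqint f := (f \in Lfun mu 2%:E).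
Local Notation rintegrable f := (mu.-integrable setT (EFin \o f)).
Implicit Types (f g : R -> R) (a b x y h : R).

Lemma EFin_Rintegral f (A : set R) : measurable A ->
  mu.-integrable A (EFin \o f) ->
  (\int[mu]_(x in A) f x)%:E = (\int[mu]_(x in A) (f x)%:E)%E.
Proof. by move=> mA /integrable_fin_num fi; rewrite /Rintegral fineK ?fi. Qed.

Lemma cvg_Rintegral_dominated (f_ : nat -> R -> R) f g :
  (forall n, measurable_fun setT (f_ n)) -> measurable_fun setT f ->
  (forall x, f_ ^~ x @ \oo --> f x) -> rintegrable g ->
  (forall n x, `|f_ n x| <= g x) ->
  (fun n => \int[mu]_x f_ n x) @ \oo --> \int[mu]_x f x.
Proof.
move=> mf_ mf f_f ig f_g.
have [] := @dominated_convergence _ _ R mu setT measurableT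
  (fun n => EFin \o f_ n) (EFin \o f) (EFin \o g).
- by move=> n; apply/measurable_EFinP; exact: mf_.
- by apply/measurable_EFinP; exact: mf.
- by apply: aeW => x _; apply/fine_cvgP; split; [exact: nearW|exact: f_f].
- exact: ig.
- by apply: aeW => x n _ /=; rewrite lee_fin.
move=> fi _; rewrite -EFin_Rintegral//.
by case/fine_cvgP.
Qed.

Lemma sqint_integrable_itv f a b : sqint f ->
  mu.-integrable `[a, b]%classic (EFin \o f).
Proof.
move=> fL; apply/integrable_mkcond => //.
have iL : sqint (\1_(`[a, b]%classic) : R -> R).
  apply: sqintP => //.
  have -> : (fun x => \1_(`[a, b]%classic) x ^+ 2) = (\1_(`[a, b]%classic) : R -> R).
    by apply/funext => x; rewrite indicE; case: (_ \in _); rewrite ?expr1n ?expr0n.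
  exact: integrable_indic_itv.
rewrite restrict_EFin.
have -> : (EFin \o f \_ `[a, b]) = (EFin \o (fun x => f x * \1_(`[a, b]%classic) x)).
  by apply/funext => x /=; rewrite patchE indicE; case: ifP; rewrite ?mulr1 ?mulr0.
exact: sqint_mul_integrable.
Qed.

Lemma sqint_locally_integrable f : sqint f -> locally_integrable setT f.
Proof.
move=> fL; split => [||K _ cK]; [exact: sqint_measurable|exact: openT|].
have [M [_ /(_ (`|M| + 1))]] := compact_bounded cK.
rewrite (le_lt_trans (ler_norm M)) ?ltrDl// => /(_ isT) bnd.
have iK := sqint_integrable_itv (- (`|M| + 1)) (`|M| + 1) fL.
have /integrableP[_] := iK.
apply: le_lt_trans; apply: ge0_subset_integral => //=.
- exact: (compact_measurable cK).
- apply/measurable_EFinP; apply: measurableT_comp => //; apply: measurable_funTS.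
  exact: (sqint_measurable fL).
- by move=> x Kx; have := bnd x Kx; rewrite /= in_itv/= ler_norml.
Qed.

Lemma sqint_hat a h : 0 < h -> sqint (hat a h).
Proof.
move=> h0; apply: (@sqint_compact_support _ _ (`|a| + 2 * h)).
  exact: continuous_hat.
move=> t H; apply: hat_out => //.
have := ler_norm a; have := ler_norm (- a); rewrite normrN => a1 a2.
by case: (lerP 0 t) => t0;
  [right; rewrite (ger0_norm t0) in H|left; rewrite (ltr0_norm t0) in H]; lra.
Qed.

Lemma Rintegral_hat a h : 0 < h -> \int[mu]_t hat a h t = 1.
Proof.
move=> h0; rewrite (@Rintegral_support _ _ `[a, a + 2 * h]%classic).
  rewrite -derive1_step Rintegral_derive1.
  - by rewrite (step_left h0 (lexx a)) (step_right h0 (lexx _)) subr0.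
  - by rewrite ltrDl mulr_gt0.
  - by move=> t; have [] := is_derive_step a h t.
  - by rewrite derive1_step; exact: continuous_hat.
move=> t /= /negP; rewrite in_itv/= negb_and -!ltNge => /orP H.
exact: hat_out.
Qed.

(** The hat at [x] has integral 1, and is at most [1 / h] and supported in the
    ball of radius [3 h] around [x], whose measure is [6 h]; its averages are thus
    controlled by those over balls. *)
Lemma hat_average_le f x h : sqint f -> 0 < h ->
  (`| (\int[mu]_t (f t * hat x h t)) - f x |%:E <= 6%:E * davg f x (3 * h))%E.
Proof.
move=> fL h0; have hL := sqint_hat x h0.
have mf := sqint_measurable fL.
have mh := sqint_measurable hL.
have ih : rintegrable (hat x h).
  have -> : (EFin \o hat x h) = (EFin \o (hat x h) \_ `[x, x + 2 * h]).
    apply/funext => t /=; rewrite patchE; case: ifPn => // /negP.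
    rewrite mem_setE in_itv/= => /negP; rewrite negb_and -!ltNge => /orP H.
    by rewrite hat_out.
  rewrite -restrict_EFin.
  by apply: (iffLR (integrable_mkcond _ _) (sqint_integrable_itv x (x + 2 * h) hL)).
have ifh := sqint_mul_integrable fL hL.
have ifxh : rintegrable (fun t => f x * hat x h t).
  exact: (integrableZl measurableT (f x) ih).
have E : \int[mu]_t (f t * hat x h t) - f x = \int[mu]_t ((f t - f x) * hat x h t).
  under [RHS]eq_Rintegral => t _ do rewrite mulrBl.
  by rewrite RintegralB// RintegralZl// Rintegral_hat// mulr1.
have id : rintegrable (fun t => (f t - f x) * hat x h t).
  have -> : (fun t => (f t - f x) * hat x h t) =
     (fun t => f t * hat x h t - f x * hat x h t).
    by apply/funext => t; rewrite mulrBl.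
  exact: (integrableB measurableT ifh ifxh).
have mfx : measurable_fun setT (fun t => f t - f x) by exact: measurable_funB.
have mafx : measurable_fun setT (fun t => (`|f t - f x|)%:E).
  by apply/measurable_EFinP; exact: measurableT_comp.
have mafxh : measurable_fun setT (fun t => (`|(f t - f x) * hat x h t|)%:E).
  by apply/measurable_EFinP; apply: measurableT_comp => //; exact: measurable_funM.
rewrite E EFin_normr_Rintegral//.
apply: (le_trans (le_abse_integral _ _ _)) => //; first by case/integrableP : id.
have -> : (\int[mu]_t `|((f t - f x) * hat x h t)%:E| =
    \int[mu]_(t in ball x (3 * h)) `|((f t - f x) * hat x h t)%:E|)%E.
  rewrite [RHS]integral_mkcond; apply: eq_integral => t _.
  rewrite patchE; case: ifPn => // /negP tx.
  suff -> : hat x h t = 0 by rewrite mulr0 abse0.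
  apply: hat_out => //.
  have {}tx : ~ (`|x - t| < 3 * h) by move=> H; apply: tx; rewrite inE.
  have [xt|xt] := ltP t x; [by left|right].
  by move/negP: tx; rewrite -leNgt ler0_norm ?subr_le0//; lra.
have h3 : 0 <= 3 * h by lra.
rewrite /davg /iavg lebesgue_measure_ball// muleA.
rewrite inver mulrn_eq0/= (gt_eqF (_ : 0 < 3 * h)) -?EFinM; last lra.
rewrite -ge0_integralZl_EFin//.
- apply: ge0_le_integral => //.
  + exact: measurable_ball.
  + exact: measurable_funTS mafxh.
  + by apply: measurable_funeM; exact: measurable_funTS mafx.
  + move=> t _; rewrite -EFinM lee_fin normrM mulrC ler_wpM2r//.
    have /andP[H0 H1] := hat_bounds x t h0.
    rewrite ger0_norm// (le_trans H1)//.
    by rewrite le_eqVlt; apply/orP; left; apply/eqP; field; rewrite gt_eqF.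
- exact: measurable_ball.
- exact: measurable_funTS mafx.
- by rewrite mulr_ge0// invr_ge0 mulrn_wge0.
Qed.

Lemma cvg_hat_average f x : sqint f -> lebesgue_pt f x ->
  (fun n => \int[mu]_t (f t * hat x (harmonic n) t)) @ \oo --> f x.
Proof.
move=> fL /cvge_at_rightP /(_ (fun n => 3 * harmonic n)) H.
have {H} : (fun n => davg f x (3 * harmonic n)) @ \oo --> 0%E.
  apply: H; split => [n|]; first by rewrite mulr_gt0 ?harmonic_gt0.
  by rewrite -[X in _ --> X](mulr0 3); apply: cvgM; [exact: cvg_cst|exact: cvg_harmonic].
move=> H; apply/subr_cvg0/norm_cvg0P.
have : (fun n => (`|\int[mu]_t (f t * hat x (harmonic n) t) - f x|)%:E) @ \oo --> 0%E.
  apply: (@squeeze_cvge _ _ _ _ (cst 0%E) _ (fun n => 6%:E * davg f x (3 * harmonic n)))%E.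
  - by apply: nearW => n; rewrite lee_fin normr_ge0/=; exact: hat_average_le.
  - exact: cvg_cst.
  - by rewrite -(mule0 6%:E); apply: cvgeZl.
by case/fine_cvgP.
Qed.

Lemma cvg_step a t : (fun n => step a (harmonic n) t) @ \oo --> (if a < t then 1 else 0 : R).
Proof.
apply: cvg_near_cst; case: ltP => at_; last first.
  by apply: nearW => n; rewrite step_left ?harmonic_gt0.
near=> n; rewrite step_right ?harmonic_gt0//.
have : harmonic n <= (t - a) / 2 :> R.
  near: n; have /cvgrPdist_le/(_ ((t - a) / 2)) := @cvg_harmonic R.
  rewrite divr_gt0 ?subr_gt0// => /(_ isT); apply: filterS => n.
  by rewrite sub0r normrN ger0_norm ?harmonic_ge0.
lra.
Unshelve. all: by end_near. Qed.

(** Test functions increasing from 0 to 1 just after [x] and decreasing back to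
    0 just after [y] turn the definition of the weak derivative into the
    fundamental theorem of calculus between Lebesgue points. *)
Lemma lebesgue_pt_increment f f1 x y : sqint f -> sqint f1 ->
  weak_derivative f f1 -> lebesgue_pt f x -> lebesgue_pt f y -> x <= y ->
  f y - f x = \int[mu]_(t in `]x, y]) f1 t.
Proof.
move=> fL f1L w fx fy; rewrite le_eqVlt => /predU1P[->|xy].
  by rewrite set_itvoc0 ?Rintegral_set0 ?subrr.
pose phi (n : nat) (t : R) : R := step x (harmonic n) t - step y (harmonic n) t.
have dphi (n : nat) (t : R) : is_derive t 1 (phi n) (hat x (harmonic n) t - hat y (harmonic n) t).
  exact: (is_deriveB (is_derive_step _ _ _) (is_derive_step _ _ _)).
have phi' n : derive1 (phi n) = (fun t => hat x (harmonic n) t - hat y (harmonic n) t).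
  by apply/funext => t; rewrite derive1E; have [] := dphi n t.
have hn0 n : 0 < harmonic n :> R by exact: harmonic_gt0.
have Cphi n : C1c (phi n).
  apply: (@C1cP _ _ _ _ (`|x| + `|y| + 2 * harmonic n)) => [t||t tN].
  - by have [] := dphi n t.
  - rewrite phi' => t; apply: cvgB; exact: continuous_hat.
  - rewrite /phi; have := hn0 n; set h := harmonic n in tN * => h0.
    have := ler_norm x; have := ler_norm (- x); have := ler_norm y; have := ler_norm (- y).
    rewrite !normrN; case: (lerP 0 t) => t0.
      rewrite (ger0_norm t0) in tN; have := normr_ge0 x; have := normr_ge0 y => *.
      by rewrite !step_right ?subrr//; lra.
    rewrite (ltr0_norm t0) in tN; have := normr_ge0 x; have := normr_ge0 y => *.
    by rewrite !step_left ?subrr//; lra.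
have key n : \int[mu]_t (f t * hat x (harmonic n) t) - \int[mu]_t (f t * hat y (harmonic n) t)
   = - \int[mu]_t (f1 t * phi n t).
  rewrite -w// phi'; under [RHS]eq_Rintegral => t _ do rewrite mulrBr.
  by rewrite RintegralB//; apply: sqint_mul_integrable => //; exact: sqint_hat.
have mf1 := sqint_measurable f1L.
have lim2 : (fun n => \int[mu]_t (f1 t * phi n t)) @ \oo --> \int[mu]_(t in `]x, y]) f1 t.
  rewrite Rintegral_mkcond.
  apply: (@cvg_Rintegral_dominated _ _ ((fun t => `|f1 t|) \_ `[x, y + 2])).
  - move=> n; apply: measurable_funM => //; apply: continuous_measurable_fun.
    by apply: derivable_continuous; case: (Cphi n).
  - by apply/(measurable_restrictT _ _).1 => //; exact: measurable_funTS.
  - move=> t; rewrite patchE mem_setE in_itv/=.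
    have -> : (if x < t <= y then f1 t else 0) = f1 t *
      ((if x < t then 1 else 0) - (if y < t then 1 else 0)).
      case: (ltP x t) => xt/=; case: (ltP y t) => yt/=; rewrite ?subrr ?subr0 ?mulr0 ?mulr1//.
      by have := lt_trans xy yt; rewrite ltNge xt.
    apply: cvgM; first exact: cvg_cst.
    by apply: cvgB; exact: cvg_step.
  - rewrite -restrict_EFin; apply: (iffLR (integrable_mkcond _ _)) => //.
    exact: (integrable_norm (sqint_integrable_itv x (y + 2) f1L)).
  - move=> n t; rewrite patchE mem_setE in_itv/= /phi.
    have h1 : harmonic n <= 1 :> R by rewrite /= invf_le1// ler1n.
    have /andP[sx0 sx1] := step_bounds x t (hn0 n).
    have /andP[sy0 sy1] := step_bounds y t (hn0 n).
    case: ifPn => [_|].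
      by rewrite normrM ler_piMr// ler_norml; apply/andP; split; lra.
    have := hn0 n; rewrite negb_and -!ltNge => h0 /orP[tx|ty].
      by rewrite !step_left ?subrr ?mulr0 ?normr0//; lra.
    by rewrite !step_right ?subrr ?mulr0 ?normr0//; lra.
have lim3 : (fun n => - \int[mu]_t (f1 t * phi n t)) @ \oo --> f x - f y.
  under eq_fun do rewrite -key.
  exact: cvgB (cvg_hat_average fL fx) (cvg_hat_average fL fy).
have E : f x - f y = - \int[mu]_(t in `]x, y]) f1 t.
  exact: cvg_unique lim3 (cvgN lim2).
lra.
Qed.

End Representative.

(** * Integration by parts in H^1(R) *)

Section IntegrationByParts.
Context {R : realType}.
Local Notation mu := (@lebesgue_measure R).
Local Notation sqint f := (f \in Lfun mu 2%:E).
Local Notation rintegrable f := (mu.-integrable setT (EFin \o f)).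
Implicit Types (f g F G : R -> R) (a b x y h : R).

Lemma aeS (P Q : R -> Prop) : (forall x, P x -> Q x) ->
  {ae mu, forall x, P x} -> {ae mu, forall x, Q x}.
Proof. exact: (@filterS _ _ (ae_filter_ringOfSetsType mu)). Qed.

Lemma ae_and (P Q : R -> Prop) : {ae mu, forall x, P x} ->
  {ae mu, forall x, Q x} -> {ae mu, forall x, P x /\ Q x}.
Proof. by apply: (@filterS2 _ _ (ae_filter_ringOfSetsType mu)) => x. Qed.

(** [F] is a primitive of [f], which is meant to be locally integrable. *)
Definition primitive f F := forall x y, x <= y ->
  F y - F x = \int[mu]_(t in `]x, y]) f t.

Lemma sqint_integrable_oc f a b : sqint f ->
  mu.-integrable `]a, b]%classic (EFin \o f).
Proof.
move=> fL; apply: integrableS (sqint_integrable_itv a b fL) => //.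
exact: subset_itv_oc_cc.
Qed.

Lemma Rintegral_oc_split f a b c : mu.-integrable `]a, c]%classic (EFin \o f) ->
  a <= b -> b <= c ->
  \int[mu]_(t in `]a, c]) f t =
  \int[mu]_(t in `]a, b]) f t + \int[mu]_(t in `]b, c]) f t.
Proof.
move=> fi ab bc; rewrite -(@Rintegral_itvB _ _ _ _ b fi) ?bnd_simp//.
by rewrite addrC subrK.
Qed.

(** A weakly differentiable function has an absolutely continuous
    representative. *)
Lemma weak_derivative_primitive f f1 : sqint f -> sqint f1 ->
  weak_derivative f f1 ->
  exists2 F, primitive f1 F & {ae mu, forall x, f x = F x}.
Proof.
move=> fL f1L w.
have ae_leb := lebesgue_differentiation (sqint_locally_integrable fL).
have [c fc] : exists c, lebesgue_pt f c.
  have pf : ProperFilter (almost_everywhere mu).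
    apply: ae_properfilter_algebraOfSetsType.
    have muT : mu [set: R] = +oo%E.
      by have := @lebesgue_measure_itv R `]-oo, +oo[; rewrite set_itvNyy.
    by change (0 < mu [set: R])%E; rewrite muT.
  exact: (filter_ex ae_leb).
pose I x y := \int[mu]_(t in `]x, y]) f1 t.
have I0 x y : y <= x -> I x y = 0.
  by move=> yx; rewrite /I set_itv_ge ?Rintegral_set0// bnd_simp -leNgt.
have ID x y z : x <= y -> y <= z -> I x z = I x y + I y z.
  by apply: Rintegral_oc_split; exact: sqint_integrable_oc.
pose F x := f c + I c x - I x c.
(* the primitive of f1 that agrees with f at the Lebesgue point c *)
exists F => [x y xy|].
  rewrite /F -/(I x y).
  have [cx|xc] := leP c x.
    by rewrite (ID c x y)// (I0 x c)// (I0 y c) ?(le_trans cx)//; ring.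
  have [cy|yc] := leP c y.
    by rewrite (I0 c x) ?(ltW xc)// (I0 y c)// (ID x c y)// ?(ltW xc)//; ring.
  by rewrite (I0 c x) ?(ltW xc)// (I0 c y) ?(ltW yc)// (ID x y c)// ?(ltW yc)//; ring.
apply: aeS ae_leb => x fx; rewrite /F.
have [cx|/ltW xc] := leP c x.
  have := lebesgue_pt_increment fL f1L w fc fx cx.
  by rewrite -/(I c x) (I0 x c)//; lra.
have := lebesgue_pt_increment fL f1L w fx fc xc.
by rewrite -/(I x c) (I0 c x)//; lra.
Qed.

Lemma primitive_unif_continuous f F a b (e : R) : sqint f -> primitive f F ->
  0 < e -> exists2 d, 0 < d &
    forall x y, a <= x -> x <= y -> y <= b -> y - x < d -> `|F y - F x| < e.
Proof.
move=> fL FP e0.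
have ik : rintegrable (f \_ `[a, b]).
  rewrite -restrict_EFin; apply: (iffLR (integrable_mkcond _ _)) => //.
  exact: sqint_integrable_itv.
have [d [d0 Hd]] := integral_normr_continuous ik e0.
exists d => // x y ax xy yb xyd; rewrite FP//.
have mxy : (mu `]x, y] < d%:E)%E.
  rewrite lebesgue_measure_itv/=; case: ifP => _; rewrite ?lte_fin//.
apply: le_lt_trans (Hd _ (measurable_itv _) mxy).
have E : {in `]x, y]%classic, f =1 f \_ `[a, b]}.
  move=> t; rewrite inE/= in_itv/= => /andP[xt ty].
  by rewrite patchE mem_set//= in_itv/= (le_trans ax (ltW xt)) (le_trans ty).
have -> : \int[mu]_(t in `]x, y]) f t = \int[mu]_(t in `]x, y]) (f \_ `[a, b]) t.
  exact: eq_Rintegral.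
apply: le_normr_Rintegral => //.
exact: integrableS ik.
Qed.

Lemma primitive_continuous f F : sqint f -> primitive f F -> continuous F.
Proof.
move=> fL FP x; apply/cvgrPdist_lt => e e0.
have [d d0 Hd] := primitive_unif_continuous (x - 1) (x + 1) fL FP e0.
near=> y.
have xy1 : `|x - y| < 1 by near: y; exact: cvgr_dist_lt.
have xyd : `|x - y| < d by near: y; exact: cvgr_dist_lt.
move: xy1 xyd => /ltr_normlP[? ?] /ltr_normlP[? ?].
have [xy|/ltW yx] := leP x y; first by rewrite distrC Hd//; lra.
by rewrite Hd//; lra.
Unshelve. all: by end_near. Qed.

Lemma integrable_oc_mul f G a b : sqint f -> continuous G ->
  mu.-integrable `]a, b]%classic (EFin \o (fun t => f t * G t)).
Proof.
move=> fL cG; have [K K0 GK] := bounded_on_segment (`|a| + `|b|) cG.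
have mf := sqint_measurable fL.
have mG : measurable_fun setT G by exact: continuous_measurable_fun.
have iK := sqint_integrable_oc a b (sqintZ K fL).
have mfG : measurable_fun setT (fun t => (f t * G t)%:E).
  by apply/measurable_EFinP; exact: measurable_funM.
apply: (le_integrable _ _ _ iK) => //; first exact: measurable_funTS mfG.
move=> t /=; rewrite in_itv/= => /andP[at_ tb].
rewrite lee_fin !normrM mulrC ler_wpM2r// (ger0_norm K0) GK//.
have := ler_norm (- a); have := ler_norm b; have := normr_ge0 a; have := normr_ge0 b.
by rewrite normrN ler_norml => *; apply/andP; split; lra.
Qed.

(** Integration by parts on a short interval, up to the oscillation of the
    primitives there. *)
Lemma primitive_mul_short f g F G x y (e : R) : sqint f -> sqint g ->
  primitive f F -> primitive g G -> x <= y ->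
  (forall t, x <= t <= y -> `|F t - F x| <= e /\ `|G y - G t| <= e) ->
  `|F y * G y - F x * G x - \int[mu]_(t in `]x, y]) (f t * G t + g t * F t)|
  <= e * \int[mu]_(t in `]x, y]) (`|f t| + `|g t|).
Proof.
move=> fL gL FP GP xy osc.
have cF := primitive_continuous fL FP; have cG := primitive_continuous gL GP.
have ifG := integrable_oc_mul x y fL cG; have igF := integrable_oc_mul x y gL cF.
have jf := sqint_integrable_oc x y fL; have jg := sqint_integrable_oc x y gL.
have ifGy : mu.-integrable `]x, y]%classic (EFin \o (fun t => G y * f t)).
  exact: sqint_integrable_oc (sqintZ _ fL).
have igFx : mu.-integrable `]x, y]%classic (EFin \o (fun t => F x * g t)).
  exact: sqint_integrable_oc (sqintZ _ gL).
have inorm : mu.-integrable `]x, y]%classic (EFin \o (fun t => `|f t| + `|g t|)).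
  exact: (integrableD _ (integrable_norm jf) (integrable_norm jg)).
have i1 : mu.-integrable `]x, y]%classic (EFin \o (fun t => G y * f t + F x * g t)).
  exact: (integrableD _ ifGy igFx).
have i2 : mu.-integrable `]x, y]%classic (EFin \o (fun t => f t * G t + g t * F t)).
  exact: (integrableD _ ifG igF).
have i3 : mu.-integrable `]x, y]%classic
    (EFin \o (fun t => (G y * f t + F x * g t) - (f t * G t + g t * F t))).
  exact: (integrableB _ i1 i2).
have -> : F y * G y - F x * G x - \int[mu]_(t in `]x, y]) (f t * G t + g t * F t) =
    \int[mu]_(t in `]x, y]) ((G y * f t + F x * g t) - (f t * G t + g t * F t)).
  rewrite RintegralB// (RintegralD _ ifGy igFx)// !RintegralZl// -(FP x y xy) -(GP x y xy).
  ring.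
apply: (le_trans (le_normr_Rintegral _ i3)) => //.
rewrite -RintegralZl//; apply: le_Rintegral => //.
- exact: integrable_norm i3.
- exact: (integrableZl _ e inorm).
move=> t /=; rewrite in_itv/= => /andP[xt ty].
have [|oF oG] := osc t; first by rewrite (ltW xt).
have -> : G y * f t + F x * g t - (f t * G t + g t * F t) =
  (G y - G t) * f t - (F t - F x) * g t by ring.
rewrite (le_trans (ler_normB _ _))// !normrM mulrDr.
by apply: lerD; apply: ler_wpM2r.
Qed.

(** Integration by parts on a bounded interval, by summing the previous
    estimate over a fine uniform partition. *)
Lemma primitive_mul f g F G a b : sqint f -> sqint g ->
  primitive f F -> primitive g G -> a <= b ->
  F b * G b - F a * G a = \int[mu]_(t in `]a, b]) (f t * G t + g t * F t).
Proof.
move=> fL gL FP GP; rewrite le_eqVlt => /predU1P[->|ab].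
  by rewrite set_itvoc0 ?Rintegral_set0 ?subrr.
have cF := primitive_continuous fL FP; have cG := primitive_continuous gL GP.
pose k t := f t * G t + g t * F t.
pose m t := `|f t| + `|g t|.
have ik x y : mu.-integrable `]x, y]%classic (EFin \o k).
  by exact: (integrableD _ (integrable_oc_mul x y fL cG) (integrable_oc_mul x y gL cF)).
have im x y : mu.-integrable `]x, y]%classic (EFin \o m).
  exact: (integrableD _ (integrable_norm (sqint_integrable_oc x y fL))
    (integrable_norm (sqint_integrable_oc x y gL))).
pose M := \int[mu]_(t in `]a, b]) m t.
have M0 : 0 <= M by apply: Rintegral_ge0 => t _; rewrite addr_ge0.
suff H e : 0 < e -> `|F b * G b - F a * G a - \int[mu]_(t in `]a, b]) k t| <= e * M.
  apply/eqP; rewrite -subr_eq0 -normr_le0; apply/ler_addgt0Pr => e e0; rewrite add0r.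
  have M1 : 0 < M + 1 by rewrite ltr_wpDl.
  apply: (le_trans (H (e / (M + 1)) _)); first by rewrite divr_gt0.
  by rewrite -mulrA ler_piMr// ?(ltW e0)// mulrC ler_pdivrMr// mul1r lerDl.
move=> e0.
have [d1 d10 H1] := primitive_unif_continuous a b fL FP e0.
have [d2 d20 H2] := primitive_unif_continuous a b gL GP e0.
pose d := Num.min d1 d2.
have d0 : 0 < d by rewrite lt_min d10.
(* n intervals of length s < d, on which F and G oscillate by at most e *)
pose n := (Num.truncn ((b - a) / d)).+1.
have n0 : 0 < n%:R :> R by rewrite ltr0n.
have ba0 : 0 < b - a by rewrite subr_gt0.
pose s := (b - a) / n%:R.
have s0 : 0 < s by rewrite divr_gt0.
have sd : s < d.
  rewrite /s ltr_pdivrMr// mulrC -ltr_pdivrMr//.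
  by apply: truncnS_gt.
pose x (i : nat) := a + i%:R * s.
have xS i : x i.+1 = x i + s by rewrite /x -natr1; ring.
have xn : x n = b by rewrite /x /s mulrC divfK ?gt_eqF//; ring.
have ax i : a <= x i by rewrite lerDl mulr_ge0// ltW.
have xb i : (i <= n)%N -> x i <= b.
  by move=> ni; rewrite -xn lerD2l ler_wpM2r ?ler_nat// ltW.
suff H i : (i <= n)%N -> `|F (x i) * G (x i) - F a * G a -
    \int[mu]_(t in `]a, x i]) k t| <= e * \int[mu]_(t in `]a, x i]) m t.
  by have := H n (leqnn n); rewrite xn.
elim: i => [_|i IH ni].
  by rewrite /x mul0r addr0 set_itvoc0 !Rintegral_set0 mulr0 !subrr normr0.
have xx : x i <= x i.+1 by rewrite xS lerDl ltW.
rewrite (Rintegral_oc_split (ik _ _) (ax i) xx) (Rintegral_oc_split (im _ _) (ax i) xx).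
have osc t : x i <= t <= x i.+1 -> `|F t - F (x i)| <= e /\ `|G (x i.+1) - G t| <= e.
  move=> /andP[xt tx]; have := xS i => xSi.
  have tb : t <= b := le_trans tx (xb _ ni).
  have xib : x i.+1 <= b by exact: xb.
  move: sd; rewrite lt_min => /andP[sd1 sd2].
  split; apply: ltW.
  - by apply: H1 => //; lra.
  - by apply: H2 => //; [exact: le_trans (ax i) xt|lra].
have H3 := primitive_mul_short fL gL FP GP xx osc.
have -> : F (x i.+1) * G (x i.+1) - F a * G a -
    (\int[mu]_(t in `]a, x i]) k t + \int[mu]_(t in `]x i, x i.+1]) k t) =
  (F (x i) * G (x i) - F a * G a - \int[mu]_(t in `]a, x i]) k t) +
  (F (x i.+1) * G (x i.+1) - F (x i) * G (x i) - \int[mu]_(t in `]x i, x i.+1]) k t) by ring.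
rewrite mulrDr (le_trans (ler_normD _ _))// lerD// IH//.
exact: ltnW.
Qed.

(** On a set of infinite measure, an integrable function takes arbitrarily small
    values, even at points which satisfy a property true almost everywhere. *)
Lemma integrable_small_at_infinity f (A : set R) (P : R -> Prop) (e : R) :
  rintegrable f -> measurable A -> mu A = +oo%E -> {ae mu, forall x, P x} ->
  0 < e -> exists x, [/\ A x, P x & `|f x| <= e].
Proof.
move=> fi mA Aoo aeP e0; apply: contrapT => /forallNP H.
have mf : measurable_fun setT (fun x => (`|f x|)%:E).
  by have /integrable_norm/(measurable_int mu) := fi.
have : (\int[mu]_(x in A) e%:E <= \int[mu]_(x in A) (`|f x|)%:E)%E.
  apply: ae_ge0_le_integral => //.
  - by move=> x _; rewrite lee_fin ltW.
  - exact: measurable_funTS mf.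
  - apply: aeS aeP => x Px Ax; rewrite lee_fin leNgt; apply/negP => fe.
    by apply: (H x); split=> //; exact: ltW.
rewrite integral_cst// [X in (e%:E * X)%E](_ : _ = +oo%E)//.
rewrite gt0_muley ?lte_fin// leye_eq => /eqP foo.
have fA : mu.-integrable A (EFin \o f) by apply: integrableS fi.
have /integrable_norm/integrableP[_] := fA.
by under eq_integral => x _ do rewrite /= normr_id; rewrite foo ltxx.
Qed.

(** The boundary terms vanish along suitable points tending to both ends, where
    the integrable product [f * g] is small. *)
Lemma H1_integration_by_parts f f1 g g1 : sqint f -> sqint f1 ->
  sqint g -> sqint g1 -> weak_derivative f f1 -> weak_derivative g g1 ->
  \int[mu]_x (f x * g1 x) = - \int[mu]_x (f1 x * g x).
Proof.
move=> fL f1L gL g1L wf wg.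
have [F FP fF] := weak_derivative_primitive fL f1L wf.
have [G GP gG] := weak_derivative_primitive gL g1L wg.
have ifg := sqint_mul_integrable fL gL.
have i1 := sqint_mul_integrable fL g1L.
have i2 := sqint_mul_integrable f1L gL.
have fgFG : {ae mu, forall x, f x = F x /\ g x = G x}.
  exact: ae_and.
pose k x := f1 x * g x + g1 x * f x.
have ik : rintegrable k.
  have -> : k = (fun x => f1 x * g x + f x * g1 x).
    by apply/funext => x; rewrite /k [g1 x * _]mulrC.
  exact: (integrableD measurableT i2 i1).
have mk : measurable_fun setT k.
  by have /(measurable_int mu)/measurable_EFinP := ik.
have mu_right (n : nat) : mu `[n%:R, +oo[%classic = +oo%E.
  by rewrite lebesgue_measure_itv/= ltry.
have mu_left (n : nat) : mu `]-oo, (- n%:R)]%classic = +oo%E.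
  by rewrite lebesgue_measure_itv/= ltNyr.
(* points x >= n and y <= - n at which the product F G is at most 1 / (n + 1) *)
have far (n : nat) : exists xy : R * R,
    [/\ n%:R <= xy.1, xy.2 <= - n%:R, `|F xy.1 * G xy.1| <= harmonic n &
        `|F xy.2 * G xy.2| <= harmonic n].
  have [x [/= nx [fx gx] xs]] := integrable_small_at_infinity ifg
    (measurable_itv `[n%:R, +oo[) (mu_right n) fgFG (harmonic_gt0 n).
  have [y [/= ny [fy gy] ys]] := integrable_small_at_infinity ifg
    (measurable_itv `]-oo, (- n%:R)]) (mu_left n) fgFG (harmonic_gt0 n).
  exists (x, y); split => /=.
  - by move: nx; rewrite in_itv/= andbT.
  - by move: ny; rewrite in_itv.
  - by rewrite -fx -gx.
  - by rewrite -fy -gy.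
have [xy Hxy] := choice far.
have lim1 : (fun n => \int[mu]_t (k \_ `](xy n).2, (xy n).1]) t) @ \oo --> \int[mu]_t k t.
  apply: (@cvg_Rintegral_dominated _ _ _ (fun t => `|k t|)) => //.
  - by move=> n; apply/(measurable_restrictT _ _).1 => //; exact: measurable_funTS.
  - move=> t; apply: cvg_near_cst; near=> n.
    rewrite patchE mem_set//= in_itv/=; have [n1 n2 _ _] := Hxy n.
    have : `|t| + 1 <= n%:R by near: n; exact: nbhs_infty_ger.
    have := ler_norm t; have := ler_norm (- t); rewrite normrN => *.
    by apply/andP; split; lra.
  - exact: integrable_norm ik.
  - by move=> n t; rewrite patchE; case: ifP => // _; rewrite normr0.
have lim2 : (fun n => \int[mu]_t (k \_ `](xy n).2, (xy n).1]) t) @ \oo --> (0 : R).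
  apply/cvgr0Pnorm_le => e e0; near=> n.
  rewrite -Rintegral_mkcond; have [n1 n2 b1 b2] := Hxy n.
  have yx : (xy n).2 <= (xy n).1.
    by have := ler0n R n; lra.
  have -> : \int[mu]_(t in `](xy n).2, (xy n).1]) k t =
     \int[mu]_(t in `](xy n).2, (xy n).1]) (f1 t * G t + g1 t * F t).
    congr fine; apply: ae_eq_integral => //.
    - by apply: measurable_funTS; apply/measurable_EFinP.
    - have cF := primitive_continuous f1L FP; have cG := primitive_continuous g1L GP.
      have iFG : mu.-integrable `](xy n).2, (xy n).1]%classic
          (EFin \o (fun t => f1 t * G t + g1 t * F t)).
        exact: (integrableD _ (integrable_oc_mul _ _ f1L cG) (integrable_oc_mul _ _ g1L cF)).
      exact: (measurable_int mu iFG).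
    - by apply: aeS fgFG => t [ft gt] _; rewrite /k ft gt.
  rewrite -primitive_mul// (le_trans (ler_normB _ _))//.
  have h2 : harmonic n <= e / 2 :> R.
    near: n; have /cvgrPdist_le/(_ (e / 2)) := @cvg_harmonic R.
    rewrite divr_gt0// => /(_ isT); apply: filterS => n.
    by rewrite sub0r normrN ger0_norm ?harmonic_ge0.
  by rewrite (splitr e) lerD// (le_trans _ h2).
have E : \int[mu]_t k t = 0 by exact: cvg_unique lim1 lim2.
move: E; rewrite /k; under eq_Rintegral => x _ do rewrite [g1 x * _]mulrC.
by rewrite RintegralD// => /eqP; rewrite addrC addr_eq0 => /eqP.
Unshelve. all: by end_near. Qed.

End IntegrationByParts.

(** * Rayleigh quotients of symmetric operators *)

Section InnerProduct.
Context {R : realType}.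
Local Notation mu := (@lebesgue_measure R).
Local Notation sqint f := (f \in Lfun mu 2%:E).
Local Notation rintegrable f := (mu.-integrable setT (EFin \o f)).
Implicit Types f g h : R -> R.

(** The inner product of L^2(R). *)
Definition ip f g : R := \int[mu]_x (f x * g x).

Lemma ipC f g : ip f g = ip g f.
Proof. by apply: eq_Rintegral => x _; rewrite mulrC. Qed.

Lemma ipDl f g h : sqint f -> sqint g -> sqint h ->
  ip (fun x => f x + g x) h = ip f h + ip g h.
Proof.
move=> fL gL hL; rewrite /ip -RintegralD//; try exact: sqint_mul_integrable.
by apply: eq_Rintegral => x _; rewrite mulrDl.
Qed.

Lemma ipZl (c : R) f h : sqint f -> sqint h ->
  ip (fun x => c * f x) h = c * ip f h.
Proof.
move=> fL hL; rewrite /ip -RintegralZl//; last exact: sqint_mul_integrable.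
by apply: eq_Rintegral => x _; rewrite mulrA.
Qed.

Lemma ipBl f g h : sqint f -> sqint g -> sqint h ->
  ip (fun x => f x - g x) h = ip f h - ip g h.
Proof.
move=> fL gL hL; rewrite /ip -RintegralB//; try exact: sqint_mul_integrable.
by apply: eq_Rintegral => x _; rewrite mulrBl.
Qed.

Lemma ip_subZ f g (t : R) : sqint f -> sqint g ->
  ip (fun x => f x - t * g x) (fun x => f x - t * g x) =
  ip f f - 2 * t * ip f g + t ^+ 2 * ip g g.
Proof.
move=> fL gL; have tgL := sqintZ t gL; have dL := sqintB fL tgL.
rewrite (ipBl fL tgL dL) (ipZl t gL dL) ![ip _ (fun x => _ - _)]ipC.
rewrite !ipBl// !ipZl// (ipC g f); ring.
Qed.

Lemma ip_ge0 f : 0 <= ip f f.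
Proof. by apply: Rintegral_ge0 => x _; rewrite -expr2 sqr_ge0. Qed.

Lemma ip_le f g h k : sqint f -> sqint g -> sqint h -> sqint k ->
  (forall x, f x * g x <= h x * k x) -> ip f g <= ip h k.
Proof.
by move=> fL gL hL kL fghk; apply: le_Rintegral => //; exact: sqint_mul_integrable.
Qed.

Lemma ip_young f g : sqint f -> sqint g -> 2 * ip f g <= ip f f + ip g g.
Proof.
move=> fL gL; have := ip_ge0 (fun x => f x - 1 * g x).
rewrite ip_subZ//; lra.
Qed.

Lemma ip_ae f g h : sqint f -> sqint g -> sqint h ->
  {ae mu, forall x, f x = g x} -> ip f h = ip g h.
Proof.
move=> fL gL hL fg; congr fine; apply: ae_eq_integral => //.
- exact: (measurable_int mu (sqint_mul_integrable fL hL)).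
- exact: (measurable_int mu (sqint_mul_integrable gL hL)).
- by apply: aeS fg => x -> _.
Qed.

End InnerProduct.

(** Three functions, standing for a function and its first two derivatives;
    [H2jet] and [C2jet] below say in which sense they are derivatives. *)
Record jet (R : realType) := Jet { jet0 : R -> R; jet1 : R -> R; jet2 : R -> R }.

Section Symmetric.
Context {R : realType}.
Local Notation mu := (@lebesgue_measure R).
Local Notation sqint f := (f \in Lfun mu 2%:E).

(** The jet of a real function of H^2(R). *)
Definition H2jet (f : jet R) :=
  [/\ sqint (jet0 f), sqint (jet1 f), sqint (jet2 f),
      weak_derivative (jet0 f) (jet1 f) & weak_derivative (jet1 f) (jet2 f)].

Definition jet_subZ (f : jet R) (t : R) (g : jet R) := Jet
  (fun x => jet0 f x - t * jet0 g x) (fun x => jet1 f x - t * jet1 g x)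
  (fun x => jet2 f x - t * jet2 g x).

Lemma weak_derivative_subZ (f f1 g g1 : R -> R) (t : R) :
  sqint f -> sqint f1 -> sqint g -> sqint g1 ->
  weak_derivative f f1 -> weak_derivative g g1 ->
  weak_derivative (fun x => f x - t * g x) (fun x => f1 x - t * g1 x).
Proof.
move=> fL f1L gL g1L wf wg phi C; have [phiL phi'L] := C1c_sqint C.
have := ipBl fL (sqintZ t gL) phi'L; rewrite (ipZl t gL phi'L) /ip => ->.
have := ipBl f1L (sqintZ t g1L) phiL; rewrite (ipZl t g1L phiL) /ip => ->.
by rewrite wf// wg//; ring.
Qed.

Lemma H2jet_subZ f t g : H2jet f -> H2jet g -> H2jet (jet_subZ f t g).
Proof.
move=> [f0 f1 f2 w1 w2] [g0 g1 g2 w3 w4]; split=> /=.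
- exact: sqintB (sqintZ t g0).
- exact: sqintB (sqintZ t g1).
- exact: sqintB (sqintZ t g2).
- exact: weak_derivative_subZ.
- exact: weak_derivative_subZ.
Qed.

(** The operator
    (a, b) |-> (a'' - q b' + c1 a + r b, b'' + q a' - r a + c2 b),
    which is formally symmetric since q' = - 2 r. A state is a pair of jets;
    [Lop1] and [Lop2] are the two components of the operator, and [K] bounds its
    coefficients. *)
Context (q r c1 c2 : R -> R) (K : R).
Context (dq : forall x, derivable q x 1) (cq' : continuous (derive1 q))
  (q'E : forall x, derive1 q x = - (2 * r x))
  (mr : measurable_fun setT r) (mc1 : measurable_fun setT c1)
  (mc2 : measurable_fun setT c2)
  (qK : forall x, `|q x| <= K) (rK : forall x, `|2 * r x| <= K)
  (c1K : forall x, `|c1 x| <= K) (c2K : forall x, `|c2 x| <= K).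

Definition Lop1 (u : jet R * jet R) (x : R) :=
  jet2 u.1 x - q x * jet1 u.2 x + c1 x * jet0 u.1 x + r x * jet0 u.2 x.
Definition Lop2 (u : jet R * jet R) (x : R) :=
  jet2 u.2 x + q x * jet1 u.1 x - r x * jet0 u.1 x + c2 x * jet0 u.2 x.

(** States of H^2(R; R^2), and the linear combination [u - t w]. *)
Definition inH2 (u : jet R * jet R) := H2jet u.1 /\ H2jet u.2.
Definition subZ (u : jet R * jet R) (t : R) (w : jet R * jet R) :=
  (jet_subZ u.1 t w.1, jet_subZ u.2 t w.2).

(** The L^2 pairing of two states, and the form <L u, w>. *)
Definition pairing (u w : jet R * jet R) :=
  ip (jet0 u.1) (jet0 w.1) + ip (jet0 u.2) (jet0 w.2).
Definition form (u w : jet R * jet R) :=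
  ip (Lop1 u) (jet0 w.1) + ip (Lop2 u) (jet0 w.2).

Lemma measurable_q : measurable_fun setT q.
Proof. by apply: continuous_measurable_fun; exact: derivable_continuous. Qed.

Lemma r_le x : `|r x| <= K.
Proof.
have := rK x; rewrite normrM (ger0_norm (ler0n R 2)).
by have := normr_ge0 (r x); lra.
Qed.

Lemma sqint_q f : sqint f -> sqint (fun x => q x * f x).
Proof. exact: sqint_bounded_mul measurable_q qK. Qed.
Lemma sqint_r f : sqint f -> sqint (fun x => r x * f x).
Proof. exact: sqint_bounded_mul mr r_le. Qed.
Lemma sqint_c1 f : sqint f -> sqint (fun x => c1 x * f x).
Proof. exact: sqint_bounded_mul mc1 c1K. Qed.
Lemma sqint_c2 f : sqint f -> sqint (fun x => c2 x * f x).
Proof. exact: sqint_bounded_mul mc2 c2K. Qed.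

Lemma sqint_Lop u : inH2 u -> sqint (Lop1 u) /\ sqint (Lop2 u).
Proof.
move=> [[f0 f1 f2 _ _] [g0 g1 g2 _ _]]; split.
  apply: sqintD; last exact: sqint_r.
  apply: sqintD; last exact: sqint_c1.
  by apply: sqintB => //; exact: sqint_q.
apply: sqintD; last exact: sqint_c2.
apply: sqintB; last exact: sqint_r.
by apply: sqintD => //; exact: sqint_q.
Qed.

(** The first order part is symmetric because q' = - 2 r. *)
Lemma ip_first_order f g : H2jet f -> H2jet g ->
  ip (fun x => r x * jet0 f x - q x * jet1 f x) (jet0 g) =
  ip (fun x => q x * jet1 g x - r x * jet0 g x) (jet0 f).
Proof.
move=> [f0 f1 _ wf _] [g0 g1 _ wg _].
have wqg : weak_derivative (fun x => q x * jet0 g x)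
    (fun x => derive1 q x * jet0 g x + q x * jet1 g x).
  apply: (@weak_derivative_mul _ _ _ _ K) => // x.
  by rewrite q'E normrN.
have rg := sqint_r g0; have qg := sqint_q g0; have qg1 := sqint_q g1.
have rf := sqint_r f0; have qf1 := sqint_q f1.
have q'g : sqint (fun x => derive1 q x * jet0 g x).
  have -> : (fun x => derive1 q x * jet0 g x) = (fun x => (- 2) * (r x * jet0 g x)).
    by apply/funext => x; rewrite q'E; ring.
  exact: sqintZ.
have := H1_integration_by_parts f0 f1 qg (sqintD q'g qg1) wf wqg.
rewrite -/(ip _ _) -/(ip _ _) => E.
rewrite !ipBl//.
have -> : ip (fun x => q x * jet1 f x) (jet0 g) = ip (jet1 f) (fun x => q x * jet0 g x).
  by apply: eq_Rintegral => x _; ring.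
have -> : ip (fun x => r x * jet0 f x) (jet0 g) = ip (fun x => r x * jet0 g x) (jet0 f).
  by apply: eq_Rintegral => x _; ring.
move: E; rewrite ipC ipDl//.
have -> : ip (fun x => derive1 q x * jet0 g x) (jet0 f) =
    (- 2) * ip (fun x => r x * jet0 g x) (jet0 f).
  by rewrite -ipZl//; apply: eq_Rintegral => x _; rewrite q'E; ring.
lra.
Qed.

Lemma ip_second_order f g : H2jet f -> H2jet g ->
  ip (jet2 f) (jet0 g) = - ip (jet1 f) (jet1 g).
Proof.
move=> [f0 f1 f2 wf wf'] [g0 g1 g2 wg wg'].
have := H1_integration_by_parts f1 f2 g0 g1 wf' wg.
by rewrite -/(ip _ _) -/(ip _ _) => ->; rewrite opprK.
Qed.

(** The form written with first derivatives only; its symmetry is then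
    apparent. *)
Lemma formE u w : inH2 u -> inH2 w ->
  form u w = - ip (jet1 u.1) (jet1 w.1) - ip (jet1 u.2) (jet1 w.2)
    + ip (fun x => c1 x * jet0 u.1 x) (jet0 w.1)
    + ip (fun x => c2 x * jet0 u.2 x) (jet0 w.2)
    + ip (fun x => q x * jet1 w.1 x - r x * jet0 w.1 x) (jet0 u.2)
    + ip (fun x => q x * jet1 u.1 x - r x * jet0 u.1 x) (jet0 w.2).
Proof.
move=> [h1 h2] [k1 k2].
rewrite -(ip_first_order h2 k1) -(ip_second_order h1 k1) -(ip_second_order h2 k2).
case: (h1) (h2) (k1) (k2) => [f0 f1 f2 _ _] [g0 g1 g2 _ _] [f0' f1' f2' _ _] [g0' g1' g2' _ _].
have rf := sqint_r f0; have qf1 := sqint_q f1; have c1f := sqint_c1 f0.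
have rg := sqint_r g0; have qg1 := sqint_q g1; have c2g := sqint_c2 g0.
have e1 := sqintB f2 qg1; have e2 := sqintD e1 c1f.
have e3 := sqintD g2 qf1; have e4 := sqintB e3 rf.
rewrite /form /Lop1 /Lop2 (ipDl e2 rg f0') (ipDl e1 c1f f0') (ipBl f2 qg1 f0').
rewrite (ipDl e4 c2g g0') (ipBl e3 rf g0') (ipDl g2 qf1 g0').
rewrite (ipBl rg qg1 f0') (ipBl qf1 rf g0').
ring.
Qed.

Lemma form_sym u w : inH2 u -> inH2 w -> form u w = form w u.
Proof.
move=> hu hw; rewrite !formE//.
have -> : ip (fun x => c1 x * jet0 w.1 x) (jet0 u.1) =
  ip (fun x => c1 x * jet0 u.1 x) (jet0 w.1) by apply: eq_Rintegral => x _; ring.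
have -> : ip (fun x => c2 x * jet0 w.2 x) (jet0 u.2) =
  ip (fun x => c2 x * jet0 u.2 x) (jet0 w.2) by apply: eq_Rintegral => x _; ring.
by rewrite (ipC (jet1 w.1)) (ipC (jet1 w.2)); ring.
Qed.

(** The form is bounded above: the only first order term which is not
    nonpositive, [2 q a' b], is absorbed by [- a' a'] up to [q^2 b^2]. *)
Lemma form_le u : inH2 u -> form u u <= (2 * K + K ^+ 2) * pairing u u.
Proof.
move=> hu; rewrite formE//; case: hu => [[f0 f1 f2 _ _] [g0 g1 g2 _ _]].
have rf := sqint_r f0; have qf1 := sqint_q f1; have c1f := sqint_c1 f0.
have c2g := sqint_c2 g0; have qg := sqint_q g0.
have K0 : 0 <= K by exact: le_trans (normr_ge0 _) (qK 0).
have b1 : ip (fun x => c1 x * jet0 u.1 x) (jet0 u.1) <= K * ip (jet0 u.1) (jet0 u.1).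
  rewrite -ipZl//; apply: ip_le => //; first exact: sqintZ.
  move=> x; rewrite -!mulrA ler_wpM2r -?expr2 ?sqr_ge0//.
  exact: le_trans (ler_norm _) (c1K x).
have b2 : ip (fun x => c2 x * jet0 u.2 x) (jet0 u.2) <= K * ip (jet0 u.2) (jet0 u.2).
  rewrite -ipZl//; apply: ip_le => //; first exact: sqintZ.
  move=> x; rewrite -!mulrA ler_wpM2r -?expr2 ?sqr_ge0//.
  exact: le_trans (ler_norm _) (c2K x).
have b3 : ip (fun x => q x * jet0 u.2 x) (fun x => q x * jet0 u.2 x)
    <= K ^+ 2 * ip (jet0 u.2) (jet0 u.2).
  rewrite -ipZl//; apply: ip_le => //; first exact: sqintZ.
  move=> x; rewrite -expr2 exprMn -mulrA -expr2 ler_wpM2r ?sqr_ge0//.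
  by rewrite -(real_normK (num_real (q x))) lerXn2r ?nnegrE.
have b4 := ip_young f1 qg.
have b5 : - 2 * ip (fun x => r x * jet0 u.1 x) (jet0 u.2) <=
    K * ip (jet0 u.1) (jet0 u.1) + K * ip (jet0 u.2) (jet0 u.2).
  have Kf := sqintZ K f0; have Kg := sqintZ K g0.
  have m2rf := sqintZ (-2) rf.
  rewrite -!ipZl// /ip -RintegralD//; try exact: sqint_mul_integrable.
  apply: le_Rintegral => //; try exact: sqint_mul_integrable.
    exact: (integrableD measurableT (sqint_mul_integrable Kf f0) (sqint_mul_integrable Kg g0)).
  move=> x _; have := rK x; rewrite ler_norml => /andP[? ?].
  set s := jet0 u.1 x; set t := jet0 u.2 x.
  have -> : - 2 * (r x * s) * t = (- (2 * r x)) * (s * t) by ring.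
  have p1 : 0 <= (K + 2 * r x) * (s + t) ^+ 2 by rewrite mulr_ge0 ?sqr_ge0//; lra.
  have p2 : 0 <= (K - 2 * r x) * (s - t) ^+ 2 by rewrite mulr_ge0 ?sqr_ge0//; lra.
  have p3 : 0 <= K * s ^+ 2 by rewrite mulr_ge0 ?sqr_ge0.
  have p4 : 0 <= K * t ^+ 2 by rewrite mulr_ge0 ?sqr_ge0.
  nra.
rewrite ipBl// (_ : ip (fun x => q x * jet1 u.1 x) (jet0 u.2) =
  ip (jet1 u.1) (fun x => q x * jet0 u.2 x)); last first.
  by apply: eq_Rintegral => x _; ring.
have := ip_ge0 (jet1 u.2); have := ip_ge0 (jet0 u.1); have := ip_ge0 (jet0 u.2).
rewrite /pairing.
set A := ip (jet0 u.1) _ in b1 b5 *; set B := ip (jet0 u.2) (jet0 u.2) in b2 b3 b5 *.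
move=> B0 A0 D0.
have : 0 <= K ^+ 2 * A by rewrite mulr_ge0 ?sqr_ge0.
lra.
Qed.

Lemma form_subZ u t w : inH2 u -> inH2 w ->
  form (subZ u t w) (subZ u t w) = form u u - 2 * t * form w u + t ^+ 2 * form w w.
Proof.
move=> hu hw; have [Lu1 Lu2] := sqint_Lop hu; have [Lw1 Lw2] := sqint_Lop hw.
have E1 : Lop1 (subZ u t w) = (fun x => Lop1 u x - t * Lop1 w x).
  by apply/funext => x; rewrite /Lop1 /=; ring.
have E2 : Lop2 (subZ u t w) = (fun x => Lop2 u x - t * Lop2 w x).
  by apply/funext => x; rewrite /Lop2 /=; ring.
have S := form_sym hu hw; move: S; rewrite /form.
case: hu hw => [[f0 _ _ _ _] [g0 _ _ _ _]] [[f0' _ _ _ _] [g0' _ _ _ _]].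
rewrite E1 E2 /=.
rewrite !ipBl ?ipZl ?sqintB ?sqintZ//.
rewrite ![ip _ (fun x => _ - _)]ipC !ipBl ?ipZl ?sqintB ?sqintZ//.
rewrite !(ipC (jet0 u.1)) !(ipC (jet0 u.2)) !(ipC (jet0 w.1)) !(ipC (jet0 w.2)) => S.
nra.
Qed.

Lemma pairing_subZ u t w : inH2 u -> inH2 w ->
  pairing (subZ u t w) (subZ u t w) =
  pairing u u - 2 * t * pairing w u + t ^+ 2 * pairing w w.
Proof.
move=> [[f0 _ _ _ _] [g0 _ _ _ _]] [[f0' _ _ _ _] [g0' _ _ _ _]].
rewrite /pairing /= !ip_subZ// (ipC (jet0 w.1) (jet0 u.1)) (ipC (jet0 w.2) (jet0 u.2)).
ring.
Qed.

Lemma pairing_ge0 u : 0 <= pairing u u.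
Proof. by rewrite addr_ge0// ip_ge0. Qed.

(** The supremum [M] of the Rayleigh quotient is in the spectrum: were
    (M - L) w = v solvable for all v with |w|^2 <= C |v|^2, the form
    <(M - L) u, u>, which is nonnegative, would be negative at u = v - t w for
    an almost maximizing v and t of the order of 1 / (1 + C). *)
Lemma rayleigh_sup_not_resolvent (m : R) v0 : inH2 v0 -> 0 < m ->
  0 < pairing v0 v0 -> m * pairing v0 v0 <= form v0 v0 ->
  exists2 M, 0 < M & forall C : R, exists2 v, inH2 v & ~ exists w,
    [/\ inH2 w, pairing w w <= C * pairing v v,
        {ae mu, forall x, Lop1 w x = M * jet0 w.1 x - jet0 v.1 x} &
        {ae mu, forall x, Lop2 w x = M * jet0 w.2 x - jet0 v.2 x}].
Proof.
move=> hv0 m0 N0 mv0.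
pose S := [set s | exists u, [/\ inH2 u, 0 < pairing u u & s * pairing u u <= form u u]].
have Sm : S m by exists v0.
have ubS : ubound S (2 * K + K ^+ 2).
  move=> s [u [hu Nu su]]; rewrite -(ler_pM2r Nu).
  exact: le_trans su (form_le hu).
have supS : has_sup S by split; [exists m|exists (2 * K + K ^+ 2)].
pose M := sup S.
have formM u : inH2 u -> form u u <= M * pairing u u.
  move=> hu; have := pairing_ge0 u; rewrite le_eqVlt => /predU1P[Nu|Nu].
    by have := form_le hu; rewrite -Nu !mulr0.
  rewrite -ler_pdivrMr//; apply: sup_upper_bound => //.
  by exists u; split=> //; rewrite divfK ?gt_eqF.
exists M; first by apply: lt_le_trans m0 _; exact: sup_upper_bound.
(* k bounds <v, w> / <v, v>; v is maximizing up to 1 / (2 k), and t = 1 / k *)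
move=> C; pose k := (1 + `|C|) / 2.
have k0 : 0 < k by rewrite divr_gt0// ltr_wpDr.
have e0 : 0 < (2 * k)^-1 by rewrite invr_gt0 mulr_gt0.
have [s [v [hv Nv sv]] Ms] := sup_adherent e0 supS.
exists v => // -[w [hw wC eq1 eq2]].
have [Lw1 Lw2] := sqint_Lop hw.
have formw u : inH2 u -> form w u = M * pairing w u - pairing v u.
  case: hw (hv) => [[f0 _ _ _ _] [g0 _ _ _ _]] [[f0' _ _ _ _] [g0' _ _ _ _]].
  move=> [[f0'' _ _ _ _] [g0'' _ _ _ _]].
  have a1 := sqintZ M f0; have a2 := sqintZ M g0.
  rewrite /form (ip_ae Lw1 (sqintB a1 f0') f0'' eq1) (ip_ae Lw2 (sqintB a2 g0') g0'' eq2).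
  by rewrite !ipBl// !ipZl// /pairing; ring.
have vw : pairing v w <= k * pairing v v.
  case: hw hv => [[f0 _ _ _ _] [g0 _ _ _ _]] [[f0' _ _ _ _] [g0' _ _ _ _]].
  have := ip_young f0' f0; have := ip_young g0' g0.
  have : pairing w w <= `|C| * pairing v v.
    by apply: le_trans wC _; rewrite ler_wpM2r ?(ltW Nv)// ler_norm.
  by rewrite /k /pairing; lra.
have hu := conj (H2jet_subZ k^-1 hv.1 hw.1) (H2jet_subZ k^-1 hv.2 hw.2).
have := formM (subZ v k^-1 w) hu.
rewrite form_subZ// pairing_subZ// (formw v hv) (formw w hw).
have : (M - (2 * k)^-1) * pairing v v <= form v v.
  by apply: le_trans sv; rewrite ler_wpM2r ?(ltW Nv)// ltW.
have : k^-1 ^+ 2 * pairing v w <= k^-1 * pairing v v.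
  by rewrite expr2 -mulrA ler_wpM2l ?invr_ge0 ?(ltW k0)// ler_pdivrMl.
have : 0 < k^-1 * pairing v v by rewrite mulr_gt0 ?invr_gt0.
have -> : (2 * k)^-1 = k^-1 / 2 by rewrite invfM mulrC.
set i := k^-1; set Nvv := pairing v v; set Nvw := pairing v w => H1 H2 H3 H4.
nra.
Qed.

End Symmetric.

(** * Localized oscillating states *)

Section TestState.
Context {R : realType}.
Local Notation mu := (@lebesgue_measure R).
Local Notation sqint f := (f \in Lfun mu 2%:E).
Local Notation rintegrable f := (mu.-integrable setT (EFin \o f)).
Implicit Types (f g : R -> R) (x : R).

Lemma is_derive_mul f g x (a b : R) : is_derive x 1 f a -> is_derive x 1 g b ->
  is_derive x 1 (fun y => f y * g y) (a * g x + f x * b).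
Proof.
move=> df dg; have := is_deriveM df dg.
by rewrite /GRing.scale/= addrC [g x * a]mulrC.
Qed.

Lemma is_derive_scale (c : R) f x (a : R) : is_derive x 1 f a ->
  is_derive x 1 (fun y => c * f y) (c * a).
Proof. exact: is_deriveZ. Qed.

Lemma is_derive_continuous f g : (forall x, is_derive x 1 f (g x)) -> continuous f.
Proof. by move=> df; apply: derivable_continuous => x; have [] := df x. Qed.

(** The jet of a C^2 function, with its classical derivatives. *)
Definition C2jet (f : jet R) := [/\ forall x, is_derive x 1 (jet0 f) (jet1 f x),
  forall x, is_derive x 1 (jet1 f) (jet2 f x) & continuous (jet2 f)].

Lemma H2jet_C2 (f : jet R) : C2jet f ->
  sqint (jet0 f) -> sqint (jet1 f) -> sqint (jet2 f) -> H2jet f.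
Proof.
move=> [d0 d1 c2] f0 f1 f2.
have e0 : derive1 (jet0 f) = jet1 f.
  by apply/funext => x; rewrite derive1E; have [] := d0 x.
have e1 : derive1 (jet1 f) = jet2 f.
  by apply/funext => x; rewrite derive1E; have [] := d1 x.
have D0 x : derivable (jet0 f) x 1 by have [] := d0 x.
have D1 x : derivable (jet1 f) x 1 by have [] := d1 x.
split=> //.
- have := @weak_derivative_C1 _ (jet0 f) D0; rewrite e0; apply => //.
  exact: is_derive_continuous d1.
- by have := @weak_derivative_C1 _ (jet1 f) D1; rewrite e1; apply.
Qed.

(** The jet of a product, by the Leibniz rule. *)
Definition jet_mul (f g : jet R) := Jet (fun x => jet0 f x * jet0 g x)
  (fun x => jet1 f x * jet0 g x + jet0 f x * jet1 g x)
  (fun x => jet2 f x * jet0 g x + 2 * (jet1 f x * jet1 g x) + jet0 f x * jet2 g x).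

Lemma C2jet_mul (f g : jet R) : C2jet f -> C2jet g -> C2jet (jet_mul f g).
Proof.
move=> [df0 df1 cf2] [dg0 dg1 cg2]; split => [x|x|] /=.
- exact: is_derive_mul.
- have := is_deriveD (is_derive_mul (df1 x) (dg0 x)) (is_derive_mul (df0 x) (dg1 x)).
  by congr (is_derive _ _ _ _); ring.
- have cf0 := is_derive_continuous df0; have cf1 := is_derive_continuous df1.
  have cg0 := is_derive_continuous dg0; have cg1 := is_derive_continuous dg1.
  move=> x; apply: cvgD; last by apply: cvgM; [exact: cf0|exact: cg2].
  apply: cvgD; first by apply: cvgM; [exact: cf2|exact: cg0].
  by apply: cvgM; [exact: cvg_cst|apply: cvgM; [exact: cf1|exact: cg1]].
Qed.

Lemma H2jet_mul_bounded (f g : jet R) (K : R) : C2jet f -> C2jet g ->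
  (forall x, [/\ `|jet0 f x| <= K, `|jet1 f x| <= K & `|jet2 f x| <= K]) ->
  sqint (jet0 g) -> sqint (jet1 g) -> sqint (jet2 g) -> H2jet (jet_mul f g).
Proof.
move=> Cf Cg fK g0 g1 g2; case: (Cf) => df0 df1 cf2.
have m0 : measurable_fun setT (jet0 f).
  by apply: continuous_measurable_fun; exact: is_derive_continuous df0.
have m1 : measurable_fun setT (jet1 f).
  by apply: continuous_measurable_fun; exact: is_derive_continuous df1.
have m2 : measurable_fun setT (jet2 f) by exact: continuous_measurable_fun.
have K0 x : `|jet0 f x| <= K by case: (fK x).
have K1 x : `|jet1 f x| <= K by case: (fK x).
have K2 x : `|jet2 f x| <= K by case: (fK x).
apply: H2jet_C2 => /=; first exact: C2jet_mul.
- exact: sqint_bounded_mul m0 K0 g0.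
- by apply: sqintD; [exact: sqint_bounded_mul m1 K1 g0|exact: sqint_bounded_mul m0 K0 g1].
- apply: sqintD; last exact: sqint_bounded_mul m0 K0 g2.
  apply: sqintD; first exact: sqint_bounded_mul m2 K2 g0.
  by apply: sqintZ; exact: sqint_bounded_mul m1 K1 g1.
Qed.

(** The jets of A cos(nu x) and of A sin(nu x). *)
Definition cos_jet (A nu : R) := Jet (fun x => A * cos (nu * x))
  (fun x => - (A * nu) * sin (nu * x)) (fun x => - (A * nu ^+ 2) * cos (nu * x)).
Definition sin_jet (A nu : R) := Jet (fun x => A * sin (nu * x))
  (fun x => (A * nu) * cos (nu * x)) (fun x => - (A * nu ^+ 2) * sin (nu * x)).

Lemma is_derive_cosM (nu x : R) :
  is_derive x 1 (fun y => cos (nu * y)) (- nu * sin (nu * x)).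
Proof.
have d : is_derive x 1 (fun y : R => nu * y) nu.
  by have := is_derive_scale nu (is_derive_id x 1); rewrite mulr1.
have := is_derive1_comp (is_derive_cos (nu * x)) d.
by congr (is_derive _ _ _ _); ring.
Qed.

Lemma is_derive_sinM (nu x : R) :
  is_derive x 1 (fun y => sin (nu * y)) (nu * cos (nu * x)).
Proof.
have d : is_derive x 1 (fun y : R => nu * y) nu.
  by have := is_derive_scale nu (is_derive_id x 1); rewrite mulr1.
have := is_derive1_comp (is_derive_sin (nu * x)) d.
by congr (is_derive _ _ _ _); ring.
Qed.

Lemma C2jet_cos A nu : C2jet (cos_jet A nu).
Proof.
split => [x|x|] /=.
- by have := is_derive_scale A (is_derive_cosM nu x); congr (is_derive _ _ _ _); ring.
- by have := is_derive_scale (- (A * nu)) (is_derive_sinM nu x);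
    congr (is_derive _ _ _ _); ring.
- by apply: is_derive_continuous => x; exact/is_derive_scale/is_derive_cosM.
Qed.

Lemma C2jet_sin A nu : C2jet (sin_jet A nu).
Proof.
split => [x|x|] /=.
- by have := is_derive_scale A (is_derive_sinM nu x); congr (is_derive _ _ _ _); ring.
- by have := is_derive_scale (A * nu) (is_derive_cosM nu x);
    congr (is_derive _ _ _ _); ring.
- by apply: is_derive_continuous => x; exact/is_derive_scale/is_derive_sinM.
Qed.

Lemma cos_sin_bounded A nu x (t : R) : `|t| <= 1 ->
  [/\ `|A * t| <= `|A| * (1 + `|nu| + nu ^+ 2),
      `|- (A * nu) * t| <= `|A| * (1 + `|nu| + nu ^+ 2),
      `|A * nu * t| <= `|A| * (1 + `|nu| + nu ^+ 2) &
      `|- (A * nu ^+ 2) * t| <= `|A| * (1 + `|nu| + nu ^+ 2)].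
Proof.
move=> t1; have n2 : 0 <= nu ^+ 2 by exact: sqr_ge0.
have n0 := normr_ge0 nu.
have H c : `|c| <= 1 + `|nu| + nu ^+ 2 -> `|A * c * t| <= `|A| * (1 + `|nu| + nu ^+ 2).
  move=> cK; rewrite -mulrA normrM ler_wpM2l// normrM.
  by rewrite -[leRHS]mulr1 ler_pM.
split.
- by have := H 1; rewrite mulr1; apply; rewrite normr1; lra.
- by rewrite mulNr normrN H//; lra.
- by rewrite H//; lra.
- by rewrite mulNr normrN H// ger0_norm//; lra.
Qed.

(** A square integrable positive function which varies slowly: |chi'| <= eta chi
    and |chi''| <= 10 eta chi when eta <= 1. *)
Section Cutoff.
Context (eta : R) (eta0 : 0 < eta) (eta1 : eta <= 1).

Definition chi x : R := (1 + (eta * x) ^+ 2)^-1.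
Definition chi_jet := Jet chi (fun x => (- 2 * eta ^+ 2) * (x * (chi x * chi x)))
  (fun x => (- 2 * eta ^+ 2) * (chi x * chi x + x *
    (2 * (chi x * ((- 2 * eta ^+ 2) * (x * (chi x * chi x))))))).

Lemma chi_gt0 x : 0 < chi x.
Proof. by rewrite invr_gt0 ltr_pwDl ?sqr_ge0. Qed.

Lemma is_derive_chi x : is_derive x 1 chi (jet1 chi_jet x).
Proof.
have d1 : is_derive x 1 (fun y : R => eta * y) eta.
  by have := is_derive_scale eta (is_derive_id x 1); rewrite mulr1.
have d2 := is_derive_mul d1 d1.
have d3 := is_deriveD (is_derive_cst (1 : R) x 1) d2.
have d4 : is_derive x 1 (fun y => 1 + (eta * y) ^+ 2) (0 + (eta * (eta * x) + eta * x * eta)).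
  exact: d3.
have nz : 1 + (eta * x) ^+ 2 != 0 :> R by rewrite gt_eqF// ltr_pwDl ?sqr_ge0.
have := @is_deriveV R (fun y => 1 + (eta * y) ^+ 2) x _ 1 nz d4.
have -> : chi = (fun y => (1 + (eta * y) ^+ 2)^-1) by [].
by congr (is_derive _ _ _ _); rewrite /GRing.scale/= /chi; field.
Qed.

Lemma C2jet_chi : C2jet chi_jet.
Proof.
have d0 := is_derive_chi.
have d1 x : is_derive x 1 (jet1 chi_jet) (jet2 chi_jet x).
  have := is_derive_scale (- 2 * eta ^+ 2)
    (is_derive_mul (is_derive_id x 1) (is_derive_mul (d0 x) (d0 x))).
  by congr (is_derive _ _ _ _); rewrite /=; ring.
split=> //.
have c0 := is_derive_continuous d0.
move=> x; apply: cvgM; first exact: cvg_cst.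
apply: cvgD; first by apply: cvgM; exact: c0.
apply: cvgM; first exact: cvg_id.
apply: cvgM; first exact: cvg_cst.
apply: cvgM; first exact: c0.
apply: cvgM; first exact: cvg_cst.
apply: cvgM; first exact: cvg_id.
by apply: cvgM; exact: c0.
Qed.

Lemma chi_jet_bounds x : `|jet1 chi_jet x| <= eta * chi x /\
  `|jet2 chi_jet x| <= 10 * eta * chi x.
Proof.
have c0 := chi_gt0 x; set z := eta * x.
have E : chi x * (1 + z ^+ 2) = 1.
  by rewrite /chi -/z mulVf// gt_eqF// ltr_pwDl ?sqr_ge0.
have z2 : chi x * z ^+ 2 <= 1 by have := E; rewrite mulrDr mulr1; lra.
have z20 : 0 <= chi x * z ^+ 2 by rewrite mulr_ge0 ?sqr_ge0 ?ltW.
have c1 : chi x <= 1 by have := E; rewrite mulrDr mulr1; lra.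
have zc : `|2 * (z * chi x)| <= 1.
  rewrite ler_norml.
  have := mulr_ge0 (ltW c0) (sqr_ge0 (z - 1)).
  have := mulr_ge0 (ltW c0) (sqr_ge0 (z + 1)).
  by move=> *; apply/andP; split; nra.
split=> /=.
  have -> : - 2 * eta ^+ 2 * (x * (chi x * chi x)) = - (eta * chi x) * (2 * (z * chi x)).
    by rewrite /z; ring.
  rewrite normrM normrN (ger0_norm (ltW (mulr_gt0 eta0 c0))) ler_piMr//.
  by rewrite ltW ?mulr_gt0.
have -> : - 2 * eta ^+ 2 * (chi x * chi x + x *
    (2 * (chi x * (- 2 * eta ^+ 2 * (x * (chi x * chi x)))))) =
  (eta * chi x) * (eta * (chi x * (8 * (chi x * z ^+ 2) - 2))) by rewrite /z; ring.
have H : `|8 * (chi x * z ^+ 2) - 2| <= 10 by rewrite ler_norml; apply/andP; split; lra.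
have H2 : `|eta * (chi x * (8 * (chi x * z ^+ 2) - 2))| <= 10.
  rewrite !normrM (gtr0_norm eta0) (gtr0_norm c0) -[leRHS]mul1r.
  by rewrite ler_pM ?mulr_ge0 ?(ltW eta0) ?(ltW c0)// -[leRHS]mul1r ler_pM ?(ltW c0).
have -> : 10 * eta * chi x = eta * chi x * 10 by ring.
by rewrite normrM (gtr0_norm (mulr_gt0 eta0 c0)) ler_wpM2l// ltW// mulr_gt0.
Qed.

Lemma integrable_oneDsqrV : rintegrable (fun x => (oneDsqr x)^-1).
Proof.
have cf : continuous (fun x : R => (oneDsqr x)^-1) by exact: continuous_oneDsqrV.
have f0 x : 0 <= (oneDsqr x)^-1 :> R.
  by rewrite invr_ge0 (le_trans ler01)// oneDsqr_ge1.
apply/integrableP; split.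
  by apply/measurable_EFinP; exact: continuous_measurable_fun.
under eq_integral => x _ do rewrite /= ger0_norm//.
rewrite ge0_symfun_integralT//; last by move=> x; rewrite /oneDsqr/= sqrrN.
by rewrite -set_itvcy integral0y_oneDsqr -EFinM ltry.
Qed.

Lemma sqint_chi : sqint chi.
Proof.
have cc : continuous chi by apply: is_derive_continuous is_derive_chi.
have mc : measurable_fun setT chi by exact: continuous_measurable_fun.
apply: sqintP => //.
apply: (@rintegrable_le _ _ (fun x => (eta ^+ 2)^-1 * (oneDsqr x)^-1)) => [||x].
- exact: measurable_funX.
- exact: (integrableZl measurableT (eta ^+ 2)^-1 integrable_oneDsqrV).
have c0 := chi_gt0 x.
have c1 : chi x <= 1.
  by rewrite /chi invf_le1 ?ltr_pwDl ?sqr_ge0// lerDl sqr_ge0.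
have o0 : 0 < oneDsqr x by rewrite (lt_le_trans ltr01)// oneDsqr_ge1.
have e2 : 0 < eta ^+ 2 by rewrite exprn_gt0.
rewrite !ger0_norm ?sqr_ge0//; last first.
  by rewrite mulr_ge0// invr_ge0 ltW.
apply: (@le_trans _ _ (chi x)); first by rewrite expr2 ler_piMr// ltW.
rewrite -invfM /chi lef_pV2 ?posrE ?mulr_gt0 ?ltr_pwDl ?sqr_ge0//.
rewrite /oneDsqr mulrDr mulr1 exprMn lerD2r.
by rewrite expr_le1// ltW.
Qed.

Lemma sqint_chi_jet : sqint (jet1 chi_jet) /\ sqint (jet2 chi_jet).
Proof.
have [d0 d1 c2] := C2jet_chi; have cL := sqint_chi; split.
  apply: sqint_le (sqintZ eta cL) _ => [|x].
    by apply: continuous_measurable_fun; exact: is_derive_continuous d1.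
  by have [+ _] := chi_jet_bounds x => /le_trans; apply; exact: ler_norm.
apply: sqint_le (sqintZ (10 * eta) cL) _ => [|x].
  exact: continuous_measurable_fun.
by have [_ +] := chi_jet_bounds x => /le_trans; apply; exact: ler_norm.
Qed.

End Cutoff.

(** The state (A cos(nu x), B sin(nu x)) multiplied by the cutoff. *)
Definition test_state (A B nu eta : R) : jet R * jet R :=
  (jet_mul (cos_jet A nu) (chi_jet eta), jet_mul (sin_jet B nu) (chi_jet eta)).

Lemma inH2_test_state A B nu eta : 0 < eta -> eta <= 1 ->
  inH2 (test_state A B nu eta).
Proof.
move=> e0 e1; have c0 := sqint_chi e0 e1; have [c1 c2] := sqint_chi_jet e0 e1.
split.
- apply: (H2jet_mul_bounded (C2jet_cos A nu) (C2jet_chi eta) _ c0 c1 c2) => x.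
  have [h1 _ _ h2] := cos_sin_bounded A nu x (cos_max (nu * x)).
  have [_ h3 _ _] := cos_sin_bounded A nu x (sin_max (nu * x)).
  by split; [exact: h1|exact: h3|exact: h2].
- apply: (H2jet_mul_bounded (C2jet_sin B nu) (C2jet_chi eta) _ c0 c1 c2) => x.
  have [h1 _ _ h2] := cos_sin_bounded B nu x (sin_max (nu * x)).
  have [_ _ h3 _] := cos_sin_bounded B nu x (cos_max (nu * x)).
  by split; [exact: h1|exact: h3|exact: h2].
Qed.

End TestState.

(** * A state of positive Rayleigh quotient *)

Section TestForm.
Context {R : realType}.
Local Notation mu := (@lebesgue_measure R).
Local Notation sqint f := (f \in Lfun mu 2%:E).
Context (A B nu k P m : R).
Context (eigen1 : - nu ^+ 2 * A - 2 * k * nu * B - 2 * P * A = m * A)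
  (eigen2 : - nu ^+ 2 * B - 2 * k * nu * A = m * B)
  (m0 : 0 < m) (nu0 : 0 < nu).
(* bounds of A^2 cos^2 + B^2 sin^2 *)
Let T := A ^+ 2 + B ^+ 2.
Let low := Num.min (A ^+ 2) (B ^+ 2).

(** The claim that L v . v >= (m / 2) |v|^2 at a point, where v is the product
    of (A cos, B sin) with a cutoff whose jet is (X0, X1, X2), for coefficients
    close to the constants q = 2 k, c1 = - 2 P and c2 = 0, at which (A cos, B sin)
    is an eigenfunction for the eigenvalue m. *)
Lemma test_pointwise (eta eps X0 X1 X2 c s dq dc1 dc2 r : R) :
  10 * eta <= m / 4 -> (2 * eta * nu + eps * nu + eps) * T <= m / 4 * low ->
  0 < X0 -> `|X1| <= eta * X0 -> `|X2| <= 10 * eta * X0 ->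
  c ^+ 2 + s ^+ 2 = 1 -> `|dq| <= eps -> `|dc1| <= eps -> `|dc2| <= eps ->
  m / 2 * (A * c * X0 * (A * c * X0) + B * s * X0 * (B * s * X0)) <=
  (- (A * nu ^+ 2) * c * X0 + 2 * (- (A * nu) * s * X1) + A * c * X2
     - (2 * k + dq) * (B * nu * c * X0 + B * s * X1)
     + (dc1 - 2 * P) * (A * c * X0) + r * (B * s * X0)) * (A * c * X0) +
  (- (B * nu ^+ 2) * s * X0 + 2 * (B * nu * c * X1) + B * s * X2
     + (2 * k + dq) * (- (A * nu) * s * X0 + A * c * X1)
     - r * (A * c * X0) + dc2 * (B * s * X0)) * (B * s * X0).
Proof.
move=> eta_le eps_le X00 X1K X2K cs dqK dc1K dc2K.
set W := A ^+ 2 * c ^+ 2 + B ^+ 2 * s ^+ 2.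
have c2 := sqr_ge0 c; have s2 := sqr_ge0 s.
have A2 := sqr_ge0 A; have B2 := sqr_ge0 B.
have T0 : 0 <= T by exact: addr_ge0.
have W0 : 0 <= W by apply: addr_ge0; apply: mulr_ge0.
have lowW : low <= W.
  have -> : low = low * c ^+ 2 + low * s ^+ 2 by rewrite -mulrDr cs mulr1.
  by rewrite lerD// ler_wpM2r// ge_min lexx ?orbT.
have WT : W <= T.
  by rewrite /W /T lerD// ler_piMr//; lra.
have eta_ge0 : 0 <= eta.
  by rewrite -(pmulr_lge0 _ X00); exact: le_trans (normr_ge0 _) X1K.
have eps_ge0 : 0 <= eps by exact: le_trans (normr_ge0 _) dqK.
have sc1 : `|s * c| <= 1.
  rewrite ler_norml; have := sqr_ge0 (s - c); have := sqr_ge0 (s + c).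
  by move=> *; apply/andP; split; nra.
(* the terms in r and those in q X1 cancel, by antisymmetry *)
have E : (- (A * nu ^+ 2) * c * X0 + 2 * (- (A * nu) * s * X1) + A * c * X2
     - (2 * k + dq) * (B * nu * c * X0 + B * s * X1)
     + (dc1 - 2 * P) * (A * c * X0) + r * (B * s * X0)) * (A * c * X0) +
  (- (B * nu ^+ 2) * s * X0 + 2 * (B * nu * c * X1) + B * s * X2
     + (2 * k + dq) * (- (A * nu) * s * X0 + A * c * X1)
     - r * (A * c * X0) + dc2 * (B * s * X0)) * (B * s * X0) =
  m * W * X0 ^+ 2 + X2 * X0 * W + X1 * X0 * (2 * nu * (B ^+ 2 - A ^+ 2)) * (s * c)
  - dq * (nu * A * B) * X0 ^+ 2 * (c ^+ 2 + s ^+ 2)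
  + X0 ^+ 2 * (dc1 * (A ^+ 2 * c ^+ 2) + dc2 * (B ^+ 2 * s ^+ 2)).
  have -> : m * W = (m * A) * A * c ^+ 2 + (m * B) * B * s ^+ 2 by rewrite /W; ring.
  by rewrite -eigen1 -eigen2 /W; ring.
rewrite E cs mulr1.
have X2b : - (10 * eta) * X0 ^+ 2 * W <= X2 * X0 * W.
  rewrite ler_wpM2r// expr2 mulrA ler_wpM2r ?(ltW X00)// mulNr.
  by move: X2K; rewrite ler_norml => /andP[].
have X1b : - (2 * eta * nu * T * X0 ^+ 2) <=
    X1 * X0 * (2 * nu * (B ^+ 2 - A ^+ 2)) * (s * c).
  have : `|X1 * X0 * (2 * nu * (B ^+ 2 - A ^+ 2)) * (s * c)| <=
      eta * X0 * X0 * (2 * nu * T) * 1.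
    rewrite normrM ler_pM// normrM ler_pM//.
      by rewrite normrM (gtr0_norm X00) ler_wpM2r// ltW.
    rewrite normrM gtr0_norm ?mulr_gt0// ler_wpM2l// ?mulr_ge0 ?(ltW nu0)//.
    by rewrite ler_norml /T; apply/andP; split; lra.
  by rewrite ler_norml => /andP[+ _]; apply: le_trans; rewrite lerN2 expr2; lra.
have dqb : dq * (nu * A * B) * X0 ^+ 2 <= eps * nu * T * X0 ^+ 2.
  rewrite ler_wpM2r ?sqr_ge0//; apply: le_trans (ler_norm _) _.
  rewrite -(mulrA eps) -(mulrA nu) normrM ler_pM// normrM (gtr0_norm nu0).
  rewrite ler_wpM2l ?(ltW nu0)//.
  rewrite ler_norml /T; have := sqr_ge0 (A - B); have := sqr_ge0 (A + B).
  by move=> *; apply/andP; split; nra.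
have dcb : - (eps * T * X0 ^+ 2) <= X0 ^+ 2 * (dc1 * (A ^+ 2 * c ^+ 2) + dc2 * (B ^+ 2 * s ^+ 2)).
  have : - eps * W <= dc1 * (A ^+ 2 * c ^+ 2) + dc2 * (B ^+ 2 * s ^+ 2).
    move: dc1K dc2K; rewrite !ler_norml => /andP[h1 _] /andP[h2 _].
    by rewrite mulrDr lerD// ler_wpM2r// mulr_ge0.
  have : eps * W <= eps * T by rewrite ler_wpM2l.
  move=> h1 h2; have -> : - (eps * T * X0 ^+ 2) = X0 ^+ 2 * (- (eps * T)) by ring.
  by rewrite ler_wpM2l ?sqr_ge0//; lra.
have H1 : 10 * eta * (X0 ^+ 2 * W) <= m / 4 * (X0 ^+ 2 * W).
  by rewrite ler_wpM2r// mulr_ge0 ?sqr_ge0.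
have H2 : (2 * eta * nu + eps * nu + eps) * T * X0 ^+ 2 <= m / 4 * W * X0 ^+ 2.
  rewrite ler_wpM2r ?sqr_ge0// (le_trans eps_le)// ler_wpM2l// ltW//.
  by rewrite divr_gt0.
have -> : A * c * X0 * (A * c * X0) + B * s * X0 * (B * s * X0) = X0 ^+ 2 * W.
  by rewrite /W; ring.
lra.
Qed.

Lemma form_test_state_ge (eta eps : R) (q r c1 c2 : R -> R) :
  0 < eta -> eta <= 1 ->
  10 * eta <= m / 4 -> (2 * eta * nu + eps * nu + eps) * T <= m / 4 * low ->
  (forall x, `|q x - 2 * k| <= eps) -> (forall x, `|c1 x + 2 * P| <= eps) ->
  (forall x, `|c2 x| <= eps) ->
  let v := test_state A B nu eta in
  sqint (Lop1 q r c1 v) -> sqint (Lop2 q r c2 v) ->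
  m / 2 * pairing v v <= form q r c1 c2 v v.
Proof.
move=> eta0 eta1 eta_le eps_le qK c1K c2K v L1 L2.
have [[f0 _ _ _ _] [g0 _ _ _ _]] := inH2_test_state A B nu eta0 eta1.
rewrite -/v in f0 g0.
have i1 := sqint_mul_integrable f0 f0; have i2 := sqint_mul_integrable g0 g0.
have i3 := sqint_mul_integrable L1 f0; have i4 := sqint_mul_integrable L2 g0.
have i5 : mu.-integrable setT
    (EFin \o (fun x => jet0 v.1 x * jet0 v.1 x + jet0 v.2 x * jet0 v.2 x)).
  exact: (integrableD measurableT i1 i2).
rewrite /pairing /form /ip -!RintegralD// -RintegralZl//.
apply: le_Rintegral => //.
- exact: (integrableZl measurableT (m / 2) i5).
- exact: (integrableD measurableT i3 i4).
move=> x _; have [X1 X2] := chi_jet_bounds eta0 eta1 x.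
have := @test_pointwise eta eps (chi eta x) (jet1 (chi_jet eta) x) (jet2 (chi_jet eta) x)
  (cos (nu * x)) (sin (nu * x)) (q x - 2 * k) (c1 x + 2 * P) (c2 x) (r x)
  eta_le eps_le (chi_gt0 eta x) X1 X2 (cos2Dsin2 _) (qK x) (c1K x) (c2K x).
move=> /le_trans; apply; rewrite le_eqVlt; apply/orP; left; apply/eqP.
rewrite /Lop1 /Lop2 /v /test_state [jet2]lock [jet1]lock /= -!lock /=.
ring.
Qed.

Lemma pairing_test_state_gt0 (eta : R) : 0 < eta -> eta <= 1 -> A != 0 -> B != 0 ->
  0 < pairing (test_state A B nu eta) (test_state A B nu eta).
Proof.
move=> eta0 eta1 An Bn; set v := test_state A B nu eta.
have [[f0 _ _ _ _] [g0 _ _ _ _]] := inH2_test_state A B nu eta0 eta1.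
rewrite -/v in f0 g0.
have i1 := sqint_mul_integrable f0 f0; have i2 := sqint_mul_integrable g0 g0.
have low0 : 0 < low by rewrite lt_min !exprn_even_gt0//= An Bn.
pose b := low / 4.
have b0 : 0 < b by rewrite divr_gt0.
have ib : mu.-integrable setT (EFin \o (fun x => b * \1_(`[0, 1]%classic) x)).
  exact: (integrableZl measurableT b (integrable_indic_itv 0 1 true false)).
apply: (@lt_le_trans _ _ (\int[mu]_x (b * \1_(`[0, 1]%classic) x))).
  rewrite RintegralZl//; last exact: (integrable_indic_itv 0 1 true false).
  rewrite mulr_gt0// /Rintegral integral_indic// setIT.
  by rewrite [X in fine X](_ : _ = 1%:E)//= lebesgue_measure_itv/= lte_fin ltr01 sube0.
rewrite /pairing /ip -RintegralD//; apply: le_Rintegral => //.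
  exact: (integrableD measurableT i1 i2).
move=> x _; rewrite indicE mem_setE in_itv/=.
have [/andP[x0 x1]|_] := boolP (0 <= x <= 1); last first.
  by rewrite mulr0 addr_ge0// -expr2 sqr_ge0.
have chi2 : 2^-1 <= chi eta x.
  rewrite /chi lef_pV2 ?posrE// ?ltr_pwDl ?sqr_ge0//.
  have : (eta * x) ^+ 2 <= 1 by rewrite expr_le1// ?mulr_ge0 ?mulr_ile1// ltW.
  lra.
have chi4 : 4^-1 <= chi eta x ^+ 2.
  have -> : 4^-1 = 2^-1 ^+ 2 :> R by rewrite expr2 -invfM; congr (_^-1); ring.
  by rewrite lerXn2r ?nnegrE// ltW ?chi_gt0.
rewrite mulr1 /=.
have cs := cos2Dsin2 (nu * x).
have lowW : low <= A ^+ 2 * cos (nu * x) ^+ 2 + B ^+ 2 * sin (nu * x) ^+ 2.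
  have -> : low = low * cos (nu * x) ^+ 2 + low * sin (nu * x) ^+ 2 by rewrite -mulrDr cs mulr1.
  by rewrite lerD// ler_wpM2r ?sqr_ge0// ge_min lexx ?orbT.
have -> : A * cos (nu * x) * chi eta x * (A * cos (nu * x) * chi eta x) +
  B * sin (nu * x) * chi eta x * (B * sin (nu * x) * chi eta x) =
  (A ^+ 2 * cos (nu * x) ^+ 2 + B ^+ 2 * sin (nu * x) ^+ 2) * chi eta x ^+ 2 by ring.
by rewrite /b ler_pM// ltW.
Qed.

End TestForm.

(** * From the complex resolvent to real states *)

Section Complexification.
Local Open Scope complex_scope.
Context {R : realType}.
Local Notation mu := (@lebesgue_measure R).
Local Notation sqint f := (f \in Lfun mu 2%:E).

Lemma Re_scale (a : R) (z : R[i]) : complex.Re (a%:C * z) = a * complex.Re z.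
Proof. by case: z => x y /=; rewrite mul0r subr0. Qed.

Lemma Re_add (y z : R[i]) : complex.Re (y + z) = complex.Re y + complex.Re z.
Proof. by case: y; case: z. Qed.

Lemma normc_sqr (z : R[i]) :
  Normc.normc z ^+ 2 = complex.Re z * complex.Re z + complex.Im z * complex.Im z.
Proof. by case: z => x y /=; rewrite sqr_sqrtr ?addr_ge0 ?sqr_ge0// !expr2. Qed.

(** Real and imaginary parts of the components of [u]. *)
Definition Rep (u : R -> 'cV[R[i]]_2) (j : 'I_2) (x : R) := complex.Re (u x j 0).
Definition Imp (u : R -> 'cV[R[i]]_2) (j : 'I_2) (x : R) := complex.Im (u x j 0).

Lemma L2norm_sqr u : L2 u -> L2norm u ^+ 2 =
  (ip (Rep u 0) (Rep u 0) + ip (Imp u 0) (Imp u 0)) +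
  (ip (Rep u 1) (Rep u 1) + ip (Imp u 1) (Imp u 1)).
Proof.
move=> uL; have [r0 i0] := uL 0; have [r1 i1] := uL 1.
rewrite /L2norm sqr_sqrtr; last first.
  by apply: Rintegral_ge0 => x _; apply: sumr_ge0 => j _; exact: sqr_ge0.
have a0 := sqint_mul_integrable r0 r0; have b0 := sqint_mul_integrable i0 i0.
have a1 := sqint_mul_integrable r1 r1; have b1 := sqint_mul_integrable i1 i1.
rewrite /ip -!RintegralD//; last 2 first.
- exact: (integrableD measurableT a0 b0).
- exact: (integrableD measurableT a1 b1).
apply: eq_Rintegral => x _; rewrite !big_ord_recl big_ord0 addr0 !normc_sqr.
by rewrite (_ : lift ord0 ord0 = 1 :> 'I_2)//; exact/val_inj.
Qed.

(** Real part of a state in H^2(R; C^2), as a pair of jets. *)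
Definition Re_state (u u1 u2 : R -> 'cV[R[i]]_2) : jet R * jet R :=
  (Jet (Rep u 0) (Rep u1 0) (Rep u2 0), Jet (Rep u 1) (Rep u1 1) (Rep u2 1)).

Lemma inH2_Re_state u u1 u2 : H2 u u1 u2 -> inH2 (Re_state u u1 u2).
Proof.
move=> [uL u1L u2L w w']; split; split => /=;
  by [case: (uL 0)|case: (u1L 0)|case: (u2L 0)|case: (w 0)|case: (w' 0)
     |case: (uL 1)|case: (u1L 1)|case: (u2L 1)|case: (w 1)|case: (w' 1)].
Qed.

(** The opposite of a real state, as a complex vector function. *)
Definition opp_state (v : jet R * jet R) (x : R) : 'cV[R[i]]_2 :=
  \col_(j < 2) (- (if j == 0 then jet0 v.1 x else jet0 v.2 x))%:C.

Lemma L2_opp_state v : inH2 v -> L2 (opp_state v).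
Proof.
move=> [[f0 _ _ _ _] [g0 _ _ _ _]] j; split.
  under eq_fun do rewrite mxE /=.
  case: (j == 0).
    have := sqintZ (-1) f0; by under eq_fun do rewrite mulN1r.
  have := sqintZ (-1) g0; by under eq_fun do rewrite mulN1r.
under eq_fun do rewrite mxE /=.
by have := sqintZ 0 f0; under eq_fun do rewrite mul0r.
Qed.

Lemma L2norm_opp_state v : inH2 v -> L2norm (opp_state v) ^+ 2 = pairing v v.
Proof.
move=> hv; rewrite L2norm_sqr; last exact: L2_opp_state.
have R0 : Rep (opp_state v) 0 = (fun x => - jet0 v.1 x).
  by apply/funext => x; rewrite /Rep mxE.
have R1 : Rep (opp_state v) 1 = (fun x => - jet0 v.2 x).
  by apply/funext => x; rewrite /Rep mxE.
have I0 j : Imp (opp_state v) j = (fun x => 0).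
  by apply/funext => x; rewrite /Imp mxE.
have i0 : ip (fun=> 0) (fun=> 0) = 0 :> R.
  by rewrite /ip; under eq_Rintegral => x _ do rewrite mulr0; rewrite Rintegral_cst// mul0r.
rewrite R0 R1 !I0 i0 !addr0 /pairing /ip.
by congr (_ + _); apply: eq_Rintegral => x _; rewrite mulrNN.
Qed.

(** Since the linearization and [M] are real, the real part of a solution for
    the real right-hand side [- v] is a solution. *)
Lemma resolvent_real_solution (omega : R) (p : R -> R) (M : R) :
  resolvent_set (linearization omega p) M%:C ->
  exists C : R, forall v, inH2 v -> exists w,
    [/\ inH2 w, pairing w w <= C * pairing v v,
        {ae mu, forall x, Lop1 (fun x => 2 * omega / p x ^+ 2)
          (fun x => 2 * omega * derive1 p x / p x ^+ 3)
          (fun x => 1 - omega ^+ 2 / p x ^+ 4 - 3 * p x ^+ 2) w x =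
          M * jet0 w.1 x - jet0 v.1 x} &
        {ae mu, forall x, Lop2 (fun x => 2 * omega / p x ^+ 2)
          (fun x => 2 * omega * derive1 p x / p x ^+ 3)
          (fun x => 1 - omega ^+ 2 / p x ^+ 4 - p x ^+ 2) w x =
          M * jet0 w.2 x - jet0 v.2 x}].
Proof.
move=> [C HC]; exists (C ^+ 2) => v hv.
have [u [[_ [u1 [u2 [Hu eq]]]] uC _]] := HC _ (L2_opp_state hv).
exists (Re_state u u1 u2); split; first exact: inH2_Re_state.
- rewrite -(L2norm_opp_state hv) -exprMn.
  apply: (@le_trans _ _ (L2norm u ^+ 2)).
    rewrite L2norm_sqr /pairing/=; last by case: Hu.
    by rewrite lerD// lerDl ip_ge0.
  by rewrite lerXn2r ?nnegrE ?(le_trans _ uC)// sqrtr_ge0.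
- apply: aeS eq => x /(congr1 (fun A : 'cV_2 => complex.Re (A 0 0))).
  rewrite !mxE !big_ord_recl !big_ord0 !mxE /= !Re_add !Re_scale /=.
  rewrite /Lop1 /= /Rep (_ : lift ord0 ord0 = 1 :> 'I_2); last exact/val_inj.
  lra.
- apply: aeS eq => x /(congr1 (fun A : 'cV_2 => complex.Re (A 1 0))).
  rewrite !mxE !big_ord_recl !big_ord0 !mxE /= !Re_add !Re_scale /=.
  rewrite /Lop2 /= /Rep (_ : lift ord0 ord0 = 1 :> 'I_2); last exact/val_inj.
  lra.
Qed.

End Complexification.

(** * Instability near the constant solution *)

Section Pattern.
Context {R : realType}.
Local Notation mu := (@lebesgue_measure R).
Implicit Types (omega k x y e : R).

(** The squares of the zeros of f are roots of s^2 - s^3 = omega^2, and the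
    smaller root lies where s^2 - s^3 increases, that is, below 2 / 3. *)
Lemma p1_sqr_lt omega (p1 p2 : R) : 0 < p1 -> p1 < p2 ->
  f_rGL omega p1 = 0 -> f_rGL omega p2 = 0 -> 3 * p1 ^+ 2 < 2.
Proof.
move=> p10 p12 f1 f2; have p20 := lt_trans p10 p12.
have sq x : 0 < x -> f_rGL omega x = 0 -> omega ^+ 2 = x ^+ 4 - x ^+ 6.
  move=> x0; rewrite /f_rGL => fx.
  have : x ^+ 3 * (- omega ^+ 2 / x ^+ 3 + x - x ^+ 3) = 0 by rewrite fx mulr0.
  rewrite mulrBr mulrDr mulrCA mulfV ?expf_neq0 ?gt_eqF// mulr1 => E.
  have E2 : omega ^+ 2 = x ^+ 3 * x - x ^+ 3 * x ^+ 3 by lra.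
  by rewrite E2; ring.
have E : p2 ^+ 4 - p2 ^+ 6 = p1 ^+ 4 - p1 ^+ 6 by rewrite -!sq.
have s12 : p1 ^+ 2 < p2 ^+ 2 by rewrite ltrXn2r ?nnegrE// ltW.
set s := p1 ^+ 2 in s12 *; set t := p2 ^+ 2 in s12 *.
have : (t - s) * (t + s - t ^+ 2 - t * s - s ^+ 2) = 0.
  have -> : (t - s) * (t + s - t ^+ 2 - t * s - s ^+ 2) =
    (p2 ^+ 4 - p2 ^+ 6) - (p1 ^+ 4 - p1 ^+ 6) by rewrite /s /t; ring.
  by rewrite E subrr.
move=> /eqP; rewrite mulf_eq0 subr_eq0 gt_eqF//= => /eqP H.
rewrite ltNge; apply/negP => s2.
have := mulr_gt0 (_ : 0 < t - s) (_ : 0 < t - s); rewrite subr_gt0 => /(_ s12 s12) d2.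
nra.
Qed.

Lemma continuous_dist_le (g : R -> R) (p1 e : R) : {for p1, continuous g} -> 0 < e ->
  exists2 d, 0 < d & forall x, `|x - p1| < d -> `|g x - g p1| <= e.
Proof.
move=> cg e0; have /cvgrPdist_le/(_ e e0) := cg.
rewrite -nbhs_nearE => /nbhs_ballP[d /= d0 H]; exists d => // x xd.
by rewrite distrC; apply: H; rewrite /ball/= distrC.
Qed.

Lemma continuous_inv_exp (c p1 : R) n : p1 != 0 ->
  {for p1, continuous (fun x => c / x ^+ n)}.
Proof.
move=> pn; apply: cvgM; first exact: cvg_cst.
by apply: cvgV; [exact: expf_neq0|exact: exprn_continuous].
Qed.

(** At the constant solution [p1] the linearization acts on
    (A cos(nu x), B sin(nu x)) as the matrix with rows
    (- nu^2 - 2 p1^2, - 2 k nu) and (- 2 k nu, - nu^2), and it has a positive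
    eigenvalue for a suitable nu since p1^2 < 2 k^2. *)
Lemma unstable_mode k (p1 : R) : 0 < k -> 0 < p1 -> k ^+ 2 + p1 ^+ 2 = 1 ->
  3 * p1 ^+ 2 < 2 -> exists A B nu m : R,
  [/\ A != 0, B != 0, 0 < nu & 0 < m] /\
  - nu ^+ 2 * A - 2 * k * nu * B - 2 * p1 ^+ 2 * A = m * A /\
  - nu ^+ 2 * B - 2 * k * nu * A = m * B.
Proof.
move=> k0 p10 kp p3; set P := p1 ^+ 2 in kp p3 *.
have P0 : 0 < P by rewrite exprn_gt0.
have k2 : 0 < k ^+ 2 by rewrite exprn_gt0.
pose s := 2 * k ^+ 2 - P.
have s0 : 0 < s by rewrite /s; lra.
pose n2 := s * (s + 2 * P) / (4 * k ^+ 2).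
have k4 : 0 < 4 * k ^+ 2 by lra.
have sP : 0 < s + 2 * P by lra.
have n20 : 0 < n2 by rewrite divr_gt0// mulr_gt0.
pose nu := Num.sqrt n2.
have nu0 : 0 < nu by rewrite sqrtr_gt0.
have nuE : nu ^+ 2 = n2 by rewrite sqr_sqrtr// ltW.
have E : 4 * k ^+ 2 * nu ^+ 2 = s * (s + 2 * P).
  by rewrite nuE /n2 mulrC divfK ?gt_eqF.
(* the eigenvalue m satisfies (m + nu^2) (m + nu^2 + 2 P) = 4 k^2 nu^2; here
   s = m + nu^2 is chosen first, and nu is deduced from it *)
exists (- s), (2 * k * nu), nu, (s - nu ^+ 2); split; last by split; nra.
split=> //.
- by rewrite oppr_eq0 gt_eqF.
- by rewrite !mulf_neq0 ?gt_eqF.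
rewrite subr_gt0 nuE /n2 ltr_pdivrMr// ltr_pM2l//.
by rewrite /s; lra.
Qed.

(** The coefficients of the linearization are uniformly close to those at [p1],
    so that the localized unstable mode still has a positive Rayleigh
    quotient. *)
Lemma spectrally_unstable_near omega k (p1 : R) : 0 < p1 -> 0 < k ->
  k ^+ 2 + p1 ^+ 2 = 1 -> k * p1 ^+ 2 = omega -> 3 * p1 ^+ 2 < 2 ->
  exists2 delta, 0 < delta & forall p : R -> R,
    (forall x, 0 < p x) -> (forall x, derivable p x 1) ->
    (forall x, derivable (derive1 p) x 1) ->
    (forall x, `|p x - p1| < delta /\ `|derive1 p x| < delta) ->
    spectrally_unstable omega p.
Proof.
move=> p10 k0 kp ko p3.
have [A [B [nu [m [[An Bn nu0 m0] [eig1 eig2]]]]]] := unstable_mode k0 p10 kp p3.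
have omega0 : 0 < omega by rewrite -ko mulr_gt0 ?exprn_gt0.
have p1n : p1 != 0 by rewrite gt_eqF.
pose T := A ^+ 2 + B ^+ 2; pose low := Num.min (A ^+ 2) (B ^+ 2).
have low0 : 0 < low by rewrite /low lt_min !exprn_even_gt0//= An Bn.
have T0 : 0 < T by rewrite /T addr_gt0 ?exprn_even_gt0//= ?An ?Bn.
pose D := 4 * ((3 * nu + 1) * T).
have D0 : 0 < D by rewrite /D !mulr_gt0// ltr_wpDl// mulr_ge0// ltW.
(* e is both the scale of the cutoff and the tolerance on the coefficients *)
pose e := Num.min (Num.min 1 (m / 40)) (m * low / D).
have e0 : 0 < e.
  by rewrite /e !lt_min ltr01 /= divr_gt0//= divr_gt0// mulr_gt0.
have e1 : e <= 1 by rewrite /e !ge_min lexx.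
have em : 10 * e <= m / 4.
  have : e <= m / 40 by rewrite /e !ge_min lexx orbT.
  lra.
have eD : (2 * e * nu + e * nu + e) * T <= m / 4 * low.
  have : e <= m * low / D by rewrite /e ge_min lexx orbT.
  rewrite ler_pdivlMr// /D; lra.
have q1 : 2 * omega / p1 ^+ 2 = 2 * k by rewrite -ko; field.
have k2 : 1 - omega ^+ 2 / p1 ^+ 4 = p1 ^+ 2.
  have -> : omega ^+ 2 / p1 ^+ 4 = k ^+ 2 by rewrite -ko; field.
  by lra.
have [d1 d10 H1] := continuous_dist_le (@continuous_inv_exp (2 * omega) p1 2 p1n) e0.
have c1c (c : R) : {for p1, continuous (fun x => 1 - omega ^+ 2 / x ^+ 4 - c * x ^+ 2)}.
  apply: cvgB; last by apply: cvgM; [exact: cvg_cst|exact: exprn_continuous].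
  by apply: cvgB; [exact: cvg_cst|exact: continuous_inv_exp].
have [d2 d20 H2] := continuous_dist_le (c1c 3) e0.
have [d3 d30 H3] := continuous_dist_le (c1c 1) e0.
pose delta := Num.min (Num.min d1 d2) (Num.min d3 (Num.min 1 (p1 / 2))).
(* delta <= p1 / 2 keeps p away from 0, and delta <= 1 bounds its derivative *)
exists delta; first by rewrite !lt_min d10 d20 d30 ltr01 divr_gt0.
move=> p pp dp ddp near_p.
have [pd1 [pd2 [pd3 [p'1 phalf]]]] : (forall x, `|p x - p1| < d1) /\
   (forall x, `|p x - p1| < d2) /\ (forall x, `|p x - p1| < d3) /\
   (forall x, `|derive1 p x| <= 1) /\ (forall x, p1 / 2 <= p x).
  have near_p' x : [/\ `|p x - p1| < d1, `|p x - p1| < d2, `|p x - p1| < d3,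
      `|derive1 p x| <= 1 & p1 / 2 <= p x].
    have [+ +] := near_p x; rewrite /delta !lt_min.
    move=> /andP[/andP[-> ->] /and3P[-> _ h]] /andP[_ /and3P[_ /ltW -> _]].
    split=> //; move: h; rewrite ltr_norml => /andP[h _]; lra.
  by do !split=> [|]; try (by move=> x; case: (near_p' x)).
(* the coefficients of the linearization about p *)
pose q x := 2 * omega / p x ^+ 2.
pose r x := 2 * omega * derive1 p x / p x ^+ 3.
pose c1 x := 1 - omega ^+ 2 / p x ^+ 4 - 3 * p x ^+ 2.
pose c2 x := 1 - omega ^+ 2 / p x ^+ 4 - p x ^+ 2.
have pn x : p x != 0 by rewrite gt_eqF.
have qe x : `|q x - 2 * k| <= e by rewrite -q1; exact: H1.
have c1e x : `|c1 x + 2 * p1 ^+ 2| <= e.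
  have := H2 _ (pd2 x); rewrite k2 -/(c1 x).
  by have -> : c1 x - (p1 ^+ 2 - 3 * p1 ^+ 2) = c1 x + 2 * p1 ^+ 2 by ring.
have c2e x : `|c2 x| <= e.
  have := H3 _ (pd3 x); rewrite k2 !mul1r.
  by rewrite subrr subr0.
have dq x : is_derive x 1 q (- (2 * r x)).
  have h1 : is_derive x 1 p (derive1 p x) by rewrite derive1E; apply: DeriveDef.
  have h2 := is_derive_mul h1 h1.
  have nz : p x * p x != 0 by rewrite mulf_neq0.
  have h3 := is_derive_scale (2 * omega) (@is_deriveV R (fun y => p y * p y) x _ 1 nz h2).
  have -> : q = (fun y => 2 * omega * (p y * p y)^-1).
    by apply/funext => y; rewrite /q expr2.
  move: h3; congr (is_derive _ _ _ _); rewrite /GRing.scale/= /r.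
  by field.
have q'E x : derive1 q x = - (2 * r x) by rewrite derive1E; have [] := dq x.
have dq0 x : derivable q x 1 by have [] := dq x.
have cp := derivable_continuous dp.
have cp' := derivable_continuous ddp.
have cinv n : continuous (fun x => (p x ^+ n)^-1).
  move=> x; apply: cvgV; first exact: expf_neq0.
  by apply: (@continuous_comp _ _ _ p (fun y => y ^+ n)); [exact: cp|exact: exprn_continuous].
have cpX n : continuous (fun x => p x ^+ n).
  move=> x; apply: (@continuous_comp _ _ _ p (fun y => y ^+ n)); first exact: cp.
  exact: exprn_continuous.
have cr : continuous r.
  move=> x; apply: cvgM; last exact: cinv.
  by apply: cvgM; [exact: cvg_cst|exact: cp'].
have cc1 : continuous c1.
  move=> x; apply: cvgB; last by apply: cvgM; [exact: cvg_cst|exact: cpX].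
  by apply: cvgB; [exact: cvg_cst|apply: cvgM; [exact: cvg_cst|exact: cinv]].
have cc2 : continuous c2.
  move=> x; apply: cvgB; last exact: cpX.
  by apply: cvgB; [exact: cvg_cst|apply: cvgM; [exact: cvg_cst|exact: cinv]].
have cq' : continuous (derive1 q).
  have -> : derive1 q = (fun x => - (2 * r x)) by apply/funext.
  by move=> x; apply: cvgN; apply: cvgM; [exact: cvg_cst|exact: cr].
pose rho := 2 * (2 * omega / (p1 / 2) ^+ 3).
have rr x : `|2 * r x| <= rho.
  rewrite /r /rho normrM ger0_norm// ler_wpM2l//.
  rewrite normrM normfV ler_pM ?invr_ge0//.
    rewrite normrM gtr0_norm ?mulr_gt0// ler_piMr// ltW// mulr_gt0//.
  rewrite gtr0_norm ?exprn_gt0// lef_pV2 ?posrE ?exprn_gt0 ?divr_gt0//.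
  by rewrite lerXn2r ?nnegrE// ?ltW// divr_gt0.
pose K := 2 * k + 2 * p1 ^+ 2 + e + rho.
have rho0 : 0 <= rho by exact: le_trans (normr_ge0 _) (rr 0).
have P0 : 0 < p1 ^+ 2 by rewrite exprn_gt0.
have qK x : `|q x| <= K.
  by move: (qe x); rewrite /K !ler_norml => /andP[? ?]; apply/andP; split; lra.
have rK x : `|2 * r x| <= K by apply: le_trans (rr x) _; rewrite /K; lra.
have c1K x : `|c1 x| <= K.
  by move: (c1e x); rewrite /K !ler_norml => /andP[? ?]; apply/andP; split; lra.
have c2K x : `|c2 x| <= K by apply: le_trans (c2e x) _; rewrite /K; lra.
have mr := continuous_measurable_fun cr.
have mc1 := continuous_measurable_fun cc1.
have mc2 := continuous_measurable_fun cc2.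
pose v0 := test_state A B nu e.
have hv0 : inH2 v0 by exact: inH2_test_state.
have [Lv1 Lv2] := sqint_Lop dq0 mr mc1 mc2 qK rK c1K c2K hv0.
have Nv0 : 0 < pairing v0 v0 by exact: pairing_test_state_gt0.
have Qv0 : m / 2 * pairing v0 v0 <= form q r c1 c2 v0 v0.
  by apply: (form_test_state_ge eig1 eig2 m0 nu0 (eps := e)).
have m20 : 0 < m / 2 by rewrite divr_gt0.
have [M M0 HM] := rayleigh_sup_not_resolvent dq0 cq' q'E mr mc1 mc2 qK rK c1K c2K
  hv0 m20 Nv0 Qv0.
exists (M%:C)%C; split => //= res.
have [C HC] := resolvent_real_solution res.
have [v hv] := HM C; apply.
exact: HC.
Qed.

End Pattern.

Unset Implicit Arguments.

Theorem proposition5p1 (R : realType) (omega : R)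
    (omega_gt0 : 0 < omega) (omega_lt : omega < Num.sqrt (4 / 27))
    (p1 p2 k : R)
    (p1_gt0 : 0 < p1) (p1_lt_p2 : p1 < p2)
    (f_p1 : f_rGL omega p1 = 0) (f_p2 : f_rGL omega p2 = 0)
    (k_p1 : k ^+ 2 + p1 ^+ 2 = 1) (k_omega : k * p1 ^+ 2 = omega) :
  exists delta : R, 0 < delta /\
    forall p theta : R -> R,
      quasi_periodic_pattern omega p theta ->
      (forall xi, `|p xi - p1| < delta /\ `|derive1 p xi| < delta) ->
      spectrally_unstable omega p.
Proof.
have k_gt0 : 0 < k by move: omega_gt0; rewrite -k_omega pmulr_lgt0// exprn_gt0.
have p3 := p1_sqr_lt p1_gt0 p1_lt_p2 f_p1 f_p2.
have [delta delta0 H] := spectrally_unstable_near p1_gt0 k_gt0 k_p1 k_omega p3.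
exists delta; split=> // p theta [p0 _ dp _ _] near_p.
by apply: H => // x; case: (dp x).
Qed.
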